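(* Let $k\ge 2$ and $m\ge 1$ be fixed integers, let $q\in[0,1]$ be fixed, and let $q_k^*=\frac{k-1}{k^2}\,k^{\frac{k-2}{k-1}}$. (a) If $0\le q\le q_k^*$, then, as $n\to\infty$, the cut bounds $C_{k,n,m}(q)$ converge to the function which is the truncated Taylor expansion (in powers of $x$, truncated at degree $m$, and evaluated at $x=1$) of the smallest solution, in $u$, of the equation $u-g(x,q,k,u)=0$. (b) If $q_k^*<q\le 1$, then, as $n\to\infty$, $C_{k,n,m}(q)\to\infty$ when $m$ is odd and $C_{k,n,m}(q)\to-\infty$ when $m$ is even.
   Context: $T_{k,n}$ is the complete $k$-ary rooted tree of depth $n$: every non-leaf node has exactly $k$ children and all leaves are at distance $n$ from the root. Let $K$ be a field and $S_{k,n}=K[x_e: e\in E(T_{k,n})]$ the standard graded polynomial ring with one variable per edge. The path ideal $I_{k,n}$ is generated by the monomials $\prod_{e\in P}x_e$, $P$ running over the edge sets of the root-to-leaf paths, and the cut ideal is its squarefree Alexander dual $J_{k,n}=\bigcap_P\langle x_e:e\in P\rangle$ (equivalently, it is generated by the monomials of the edge sets whose removal disconnects the root from all leaves). Put $\beta_{i,j}(S_{k,n}/J_{k,n})=\dim_K\mathrm{Tor}_i^{S_{k,n}}(S_{k,n}/J_{k,n},K)_j$ and $$\tilde{\mathcal H}_{k,n}(x,t)=-\sum_{i,j>0}(-1)^i\beta_{i,j}(S_{k,n}/J_{k,n})\,x^it^j .$$ For a power series $f(x)=\sum_{i\ge0}c_ix^i$ let $T_m(f(x))=\sum_{i=0}^m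 c_ix^i$. The cut bounds are $$C_{k,n,m}(q)=T_m\bigl(\tilde{\mathcal H}_{k,n}(x,q)\bigr)\big|_{x=1},$$ where $q$ is the common failure probability of the edges. Finally $$g(x,t,k,u)=(-1)^k\frac{1}{x^{k-1}}\bigl((1-tx)(1-u)-1\bigr)^k ,$$ and the solution $u$ of $u-g(x,q,k,u)=0$ is regarded as a function of $x$ (with $k$ and $q$ fixed).
   Formalization: ''Smallest solution'' means smallest nonnegative solution, for small x>0 (odd k has a spurious negative root). At q=q_k^* with m≥2 this solution has no Taylor expansion of order m at 0, so there convergence is claimed only if one exists; q<q_k^* and m=1 are covered in full. *)

(* Defs.v *)
From HB Require Import structures.
From mathcomp Require Import all_boot all_order all_algebra.
From mathcomp Require mpoly.

Set Implicit Arguments.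
Unset Strict Implicit.
Unset Printing Implicit Defensive.

Import Order.TTheory GRing.Theory Num.Theory.
Local Open Scope ring_scope.

(* The import of mpoly is confined to this module because its notations clash *)
(* with those of mathcomp-analysis, which is imported below.                  *)
Module CutAlgebra.
Import mpoly.

Section Tor.
Variables (K : fieldType) (N : nat).
Local Notation S := {mpoly K[N]}.

(* A graded free resolution                                                   *)
(*    ... -> F_2 -> F_1 -> F_0 -> S/J -> 0                                    *)
(* by free modules of finite rank.  F_i has a basis indexed by                *)
(* 'I_(gfr_rank i), its a-th vector having degree [gfr_deg a]; elements of    *)
(* F_i are row vectors, and the differential F_(i+1) -> F_i is                *)
(* v |-> v *m gfr_diff i.  The augmentation F_0 -> S/J maps the a-th basis    *)
(* vector to the class of [gfr_aug a 0].                                      *)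
Record graded_free_resolution (J : S -> Prop) := GradedFreeResolution {
  gfr_rank : nat -> nat;
  gfr_deg : forall i, 'I_(gfr_rank i) -> nat;
  gfr_diff : forall i, 'M[S]_(gfr_rank i.+1, gfr_rank i);
  gfr_aug : 'cV[S]_(gfr_rank 0);
  gfr_diff_homog : forall i a b, (gfr_deg b <= gfr_deg a)%N ->
    gfr_diff i a b \is (gfr_deg a - gfr_deg b).-homog;
  gfr_diff_eq0 : forall i a b, (gfr_deg a < gfr_deg b)%N ->
    gfr_diff i a b = 0;
  gfr_aug_homog : forall a, gfr_aug a 0 \is (gfr_deg a).-homog;
  gfr_aug_surj : forall f : S,
    exists v : 'rV[S]_(gfr_rank 0), J (f - (v *m gfr_aug) 0 0);
  gfr_aug_exact : forall v : 'rV[S]_(gfr_rank 0),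
    J ((v *m gfr_aug) 0 0) <->
    exists w : 'rV[S]_(gfr_rank 1), v = w *m gfr_diff 0;
  gfr_diff_exact : forall i (v : 'rV[S]_(gfr_rank i.+1)),
    v *m gfr_diff i = 0 <->
    exists w : 'rV[S]_(gfr_rank i.+2), v = w *m gfr_diff i.+1
}.

Variables (J : S -> Prop) (F : graded_free_resolution J).

(* The differential of F (x)_S K, where K = S/<x_1,...,x_N>: each entry is    *)
(* replaced by its constant coefficient.                                      *)
Definition fibre_diff i : 'M[K]_(gfr_rank F i.+1, gfr_rank F i) :=
  map_mx (mcoeff 0%MM) (gfr_diff F i).

(* Subspaces are row spaces of matrices, as in mxalgebra.                     *)
Definition fibre_part i (j : nat) : 'M[K]_(gfr_rank F i) :=
  diag_mx (\row_a (@gfr_deg J F i a == j)%:R).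

Definition fibre_cycles i j : 'M[K]_(gfr_rank F i) :=
  match i with
  | 0 => fibre_part 0 j
  | i'.+1 => (fibre_part i'.+1 j :&: kermx (fibre_diff i'))%MS
  end.

Definition fibre_boundaries i j : 'M[K]_(gfr_rank F i.+1, gfr_rank F i) :=
  fibre_part i.+1 j *m fibre_diff i.

(* dim_K Tor_i^S(S/J, K)_j, as the dimension of H_i(F (x)_S K)_j.             *)
Definition betti (i j : nat) : nat :=
  (\rank (fibre_cycles i j) - \rank (fibre_boundaries i j))%N.

End Tor.

(* The vertices of T_(k,n) are the words of length at most n over 'I_k, the   *)
(* root being the empty word and the children of v the words [rcons v c]; the *)
(* leaves are the words of length n.  An edge is identified with its endpoint *)
(* away from the root, and it lies on the path from the root to the leaf w    *)
(* when that endpoint is a prefix of w.                                       *)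
Definition edge (k n : nat) := {v : n.-bseq 'I_k | v != [::] :> seq 'I_k}.

Definition on_path k n (w : n.-tuple 'I_k) (e : edge k n) : bool :=
  prefix (val e) w.

Section CutIdeal.
Variables (K : fieldType) (k n : nat).
Local Notation S := {mpoly K[#|{: edge k n}|]}.

Definition edge_var (e : edge k n) : S := 'X_(enum_rank e).

Definition path_prime (w : n.-tuple 'I_k) (f : S) : Prop :=
  exists c : edge k n -> S, f = \sum_(e | on_path w e) c e * edge_var e.

Definition cut_ideal (f : S) : Prop :=
  forall w : n.-tuple 'I_k, path_prime w f.

End CutIdeal.

End CutAlgebra.
Export CutAlgebra.

From mathcomp Require Import all_classical all_reals all_analysis.
Import numFieldNormedType.Exports.
Local Open Scope classical_set_scope.

(* Power series are represented by their sequences of coefficients;           *)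
(* [trunc_series m c x] is T_m of the series, evaluated at x.                 *)
Definition trunc_series (R : realType) (m : nat) (c : nat -> R) (x : R) : R :=
  \sum_(i < m.+1) c i * x ^+ i.

Section CutBound.
Variables (R : realType) (K : fieldType) (k n : nat).
Variable F : graded_free_resolution (@cut_ideal K k n).

(* The coefficient of x^i in the series H~(x, t).  For fixed i only finitely  *)
(* many graded Betti numbers are nonzero, so the sum over j is finite.        *)
Definition Htilde (t : R) (i : nat) : R :=
  if i is 0%N then 0
  else - \sum_(j \in [set j | (0 < j)%N])
            (-1) ^+ i * (betti F i j)%:R * t ^+ j.

Definition cut_bound (m : nat) (q : R) : R := trunc_series m (Htilde q) 1.

End CutBound.

Section Limit.
Variable R : realType.
Implicit Types (x t q : R) (u : R -> R) (c : nat -> R) (k m : nat).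

Definition cut_g x t k (u : R) : R :=
  (-1) ^+ k * (1 / x ^+ k.-1) * ((1 - t * x) * (1 - u) - 1) ^+ k.

(* For odd k the equation also has a negative root, which is never the limit  *)
(* of the bounds; for even k and x > 0 every real root is nonnegative.        *)
Definition smallest_solution k q x (u : R) : Prop :=
  [/\ 0 <= u, u - cut_g x q k u = 0 &
      forall w : R, 0 <= w -> w - cut_g x q k w = 0 -> u <= w].

Definition power_series_expansion u c : Prop :=
  \forall x \near 0^'+, trunc_series N c x @[N --> \oo] --> u x.

(* The coefficients c_0, ..., c_m are those of the Taylor polynomial of u at  *)
(* 0 from the right: u x = T_m c x + o(x^m) as x -> 0+.                       *)
Definition taylor_expansion m u c : Prop :=
  (u x - trunc_series m c x) / x ^+ m @[x --> 0^'+] --> 0.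

Definition qstar k : R :=
  (k%:R - 1) / k%:R ^+ 2 * k%:R `^ ((k%:R - 2) / (k%:R - 1)).

End Limit.

(* Main.v *)
Require Import Defs.
From HB Require Import structures.
From mathcomp Require Import all_boot all_order all_algebra.
From mathcomp Require mpoly boolp.
Import Order.TTheory GRing.Theory Num.Theory.

Set Implicit Arguments.
Unset Strict Implicit.
Unset Printing Implicit Defensive.

(** The algebra gives a recursion.  Take a forest of disjoint subtrees hanging
    from edges, and let e be the edge of its first tree v.  A set of edges cuts
    the forest iff it contains e and cuts the other trees, or it cuts the
    forest in which v is replaced by the trees at its children.  So the cut
    ideal is x_e I + M, where I and M are the cut ideals of these two other
    forests; M is contained in I and neither involves x_e.  A mapping cone
    then resolves it: its generators are those of I multiplied by x_e, those
    of M, and those of M multiplied by x_e and moved up by one homological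
    degree [frame_cone].  The cone is minimal because every generator of M
    uses an edge below v, and no generator of I does.  Induction on the forest
    [forest_frame] yields, for the generating function of the generators with
    weight (-x)^(homological degree) t^(degree), that a forest contributes the
    product over its trees of the polynomials b_h with b_0 = t and
    b_(h+1) = t + (1 - t x) b_h^k.  The graded Betti numbers of an arbitrary
    resolution are the numbers of generators of this minimal one
    [betti_minimal], so the series of the theorem is x a_n(x) where a_0 = 0
    and a_(n+1) = (t + (1 - t x) a_n)^k [Htilde_coef].

    The rest is the study of that iteration at t = q.  Substituting u = x a
    turns u = g(x, q, k, u) into the fixed point equation of the step
    s |-> (q + (1 - q x) s)^k [cut_gE].  For q <= q* and 0 <= x <= 1 the
    interval from 0 to b* - q, where k b*^(k-1) = 1 and q* = b* - b*^k, is
    mapped into itself by this increasing step, so the values a_n(x) increase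
    to its smallest fixed point and u(x) = x lim a_n(x) is the smallest
    solution [solution_smallest].

    For q < q* the same trap still works at some x = -y < 0.  The polynomials
    a_n(-x) have nonnegative coefficients which increase with n, and boundedness
    at y makes them converge, uniformly enough to identify the limits with the
    power series of u [solution_approx]; Taylor coefficients being unique, this
    settles every Taylor expansion of u.  At q = q* the two fixed points for
    x = 0 merge and u(x)/x approaches its limit like the square root of x: the
    expansion of order 1 exists [solution_taylor1] and none of order 2 does
    [critical_not_taylor2].

    For q > q* the constant coefficients of the a_n have no finite limit, as it
    would be a fixed point, so they tend to infinity.  Put f = a_n(-x).  If
    f' >= rho f coefficientwise, then (f^k)' = k f' f^(k-1) >= k rho f^k, and the
    affine part of the step costs only a factor tending to 1; hence the
    ratios of consecutive coefficients tend to infinity [grows_unbounded] and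
    the alternating truncated sum is dominated by its last term, whose sign
    is (-1)^(m-1) [alternating_unbounded]. *)

Module CutResolution.
Import mpoly.
Local Open Scope ring_scope.

(** * Graded matrices over a polynomial ring *)
(** Chain maps, homotopies and liftings are all built degree by degree, each
    stage depending on the previous one. *)
Lemma dependent_choice (T : nat -> Type) (P : forall i, T i -> Prop)
    (Q : forall i, T i -> T i.+1 -> Prop) :
  (exists x, P 0%N x) ->
  (forall i x, P i x -> exists2 y, P i.+1 y & Q i x y) ->
  exists f : forall i, T i,
    (forall i, P i (f i)) /\ (forall i, Q i (f i) (f i.+1)).
Proof.
move=> /boolp.cid[x0 Px0] step.
have next i (x : {x : T i | P i x}) :
  {y : {y : T i.+1 | P i.+1 y} | Q i (sval x) (sval y)}.
  case: x => x Px; have /boolp.cid2[y Py Qxy] := step i x Px.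
  by exists (exist _ y Py).
pose f := nat_rect (fun i => {x : T i | P i x}) (exist _ x0 Px0)
  (fun i x => sval (next i x)).
exists (fun i => sval (f i)); split=> i; first exact: (svalP (f i)).
exact: (svalP (next i (f i))).
Qed.

Section Support.
Variables (K : fieldType) (N : nat).
Local Notation S := {mpoly K[N]}.

Definition mfilter (P : pred 'X_{1..N}) (p : S) : S :=
  \sum_(m <- msupp p | P m) p@_m *: 'X_[m].

Lemma mcoeff_mfilter P p m : (mfilter P p)@_m = if P m then p@_m else 0.
Proof.
rewrite /mfilter raddf_sum /=.
under eq_bigr do rewrite mcoeffZ mcoeffX.
have [pm|] := boolP (m \in msupp p); last first.
  move=> npm; rewrite big1_seq => [|m' /andP[_ pm']].
    by rewrite memN_msupp_eq0 // if_same.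
  by case: eqP => [e|]; [rewrite e (negPf npm) in pm'|rewrite mulr0].
case: ifPn => Pm.
  rewrite (big_rem m) //= Pm eqxx mulr1 big1_seq ?addr0 // => m' /andP[_].
  rewrite mem_rem_uniq ?msupp_uniq // inE => /andP[/negPf-> _].
  by rewrite mulr0.
rewrite big1 // => m' Pm'; case: eqP => [e|]; last by rewrite mulr0.
by rewrite -e Pm' in Pm.
Qed.

Lemma mulmx_coeff_neq0 r s c (A : 'M[S]_(r, s)) (B : 'M[S]_(s, c)) a d m :
  ((A *m B) a d)@_m != 0 -> exists b m1 m2,
  [/\ m = (m1 + m2)%MM, (A a b)@_m1 != 0 & (B b d)@_m2 != 0].
Proof.
rewrite mxE raddf_sum /= => nz.
have [b nzb] : exists b, (A a b * B b d)@_m != 0.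
  apply/existsP; apply: contraNT nz => /existsPn h.
  by rewrite big1 // => b _; apply/eqP; have := h b; rewrite negbK.
rewrite mcoeffM in nzb.
have [k /andP[/eqP mk nzk]] : exists k : 'X_{1..N < (mdeg m).+1, (mdeg m).+1},
    (m == (k.1 + k.2)%MM) && ((A a b)@_k.1 * (B b d)@_k.2 != 0).
  apply/existsP; apply: contraNT nzb => /existsPn h.
  rewrite big1 // => k mk; apply/eqP; have := h k.
  by rewrite mk /= negbK.
exists b, k.1, k.2; split=> //.
  by apply: contraNneq nzk => ->; rewrite mul0r.
by apply: contraNneq nzk => ->; rewrite mulr0.
Qed.

(** With rows and columns carrying degrees, these are the matrices of the
    degree-preserving maps of graded free modules. *)
Definition graded r c (dr : 'I_r -> nat) (dc : 'I_c -> nat) (A : 'M[S]_(r, c)) :=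
  forall a b m, (A a b)@_m != 0 -> (mdeg m + dc b)%N = dr a.

Lemma graded_mul r s c (dr : 'I_r -> nat) (ds : 'I_s -> nat) (dc : 'I_c -> nat)
    (A : 'M[S]_(r, s)) (B : 'M[S]_(s, c)) :
  graded dr ds A -> graded ds dc B -> graded dr dc (A *m B).
Proof.
move=> gA gB a d m /mulmx_coeff_neq0[b [m1 [m2 [-> /gA <- /gB <-]]]].
by rewrite mdegD addnA.
Qed.

Lemma gradedB r c (dr : 'I_r -> nat) (dc : 'I_c -> nat) (A B : 'M[S]_(r, c)) :
  graded dr dc A -> graded dr dc B -> graded dr dc (A - B).
Proof.
move=> gA gB a b m; rewrite !mxE mcoeffB => nz.
have [/eqP A0|/gA//] := boolP ((A a b)@_m == 0).
by apply: gB; apply: contraNneq nz => ->; rewrite A0 subrr.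
Qed.

Lemma graded1 r (dr : 'I_r -> nat) : graded dr dr 1%:M.
Proof.
move=> a b m; rewrite mxE; have [->|_] := eqVneq a b; last first.
  by rewrite mulr0n mcoeff0 eqxx.
rewrite ?eqxx mulr1n mcoeff1; case: (m =P 0%MM) => [->|_]; first by rewrite mdeg0.
by rewrite eqxx.
Qed.

(** A factorization obtained from exactness has no reason to be graded;
    keeping the monomials of the right degree repairs it, since this commutes
    with multiplication by a graded matrix. *)
Definition graded_part r c (dr : 'I_r -> nat) (dc : 'I_c -> nat)
    (A : 'M[S]_(r, c)) : 'M[S]_(r, c) :=
  \matrix_(a, b) mfilter (fun m => (mdeg m + dc b)%N == dr a) (A a b).

Lemma graded_partP r c (dr : 'I_r -> nat) (dc : 'I_c -> nat)
    (A : 'M[S]_(r, c)) : graded dr dc (graded_part dr dc A).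
Proof.
by move=> a b m; rewrite mxE mcoeff_mfilter; case: ifP => [/eqP//|]; rewrite eqxx.
Qed.

Lemma graded_part_id r c (dr : 'I_r -> nat) (dc : 'I_c -> nat)
    (A : 'M[S]_(r, c)) : graded dr dc A -> graded_part dr dc A = A.
Proof.
move=> gA; apply/matrixP => a b; apply/mpolyP => m; rewrite mxE mcoeff_mfilter.
case: ifPn => // /eqP ne; apply/esym/eqP; apply/negPn/negP => nz.
by case: ne; apply: gA nz.
Qed.

Lemma graded_partB r c (dr : 'I_r -> nat) (dc : 'I_c -> nat)
    (A B : 'M[S]_(r, c)) :
  graded_part dr dc (A - B) = graded_part dr dc A - graded_part dr dc B.
Proof.
apply/matrixP => a b; apply/mpolyP => m; rewrite !mxE mcoeffB !mcoeff_mfilter.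
by rewrite mcoeffB; case: ifP => // _; rewrite subrr.
Qed.

Lemma graded_part_mul r s c (dr : 'I_r -> nat) (ds : 'I_s -> nat)
    (dc : 'I_c -> nat) (A : 'M[S]_(r, s)) (B : 'M[S]_(s, c)) :
  graded ds dc B ->
  graded_part dr dc (A *m B) = graded_part dr ds A *m B.
Proof.
move=> gB; rewrite -(graded_part_id (graded_mul (@graded_partP _ _ dr ds A) gB)).
apply/eqP; rewrite -subr_eq0 -graded_partB -mulmxBl; apply/eqP/matrixP => a d.
apply/mpolyP => m; rewrite [in LHS]mxE [in RHS]mxE mcoeff_mfilter mcoeff0.
case: ifP => // /eqP e.
apply/eqP; apply/negPn/negP => /mulmx_coeff_neq0[b [m1 [m2 [em nA nB]]]].
move: e nA; rewrite em mdegD -addnA (gB _ _ _ nB) => e.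
by rewrite !mxE mcoeffB mcoeff_mfilter e eqxx subrr eqxx.
Qed.

(** Tensoring with the residue field K = S/<x_1,...,x_N>. *)
Definition at0 r c (A : 'M[S]_(r, c)) : 'M[K]_(r, c) := map_mx (mcoeff 0%MM) A.

Lemma at0M r s c (A : 'M[S]_(r, s)) (B : 'M[S]_(s, c)) :
  at0 (A *m B) = at0 A *m at0 B.
Proof. exact: map_mxM. Qed.
Lemma at0B r c (A B : 'M[S]_(r, c)) : at0 (A - B) = at0 A - at0 B.
Proof. exact: map_mxB. Qed.
Lemma at0D r c (A B : 'M[S]_(r, c)) : at0 (A + B) = at0 A + at0 B.
Proof. exact: map_mxD. Qed.
Lemma at01 r : at0 (1%:M : 'M[S]_r) = 1%:M.
Proof. exact: map_mx1. Qed.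

Definition part_mx r (d : 'I_r -> nat) (j : nat) : 'M[K]_r :=
  diag_mx (\row_a (d a == j)%:R).

Lemma part_mxC r c (dr : 'I_r -> nat) (dc : 'I_c -> nat) (A : 'M[S]_(r, c)) j :
  graded dr dc A -> part_mx dr j *m at0 A = at0 A *m part_mx dc j.
Proof.
move=> gA; apply/matrixP => a b; rewrite mul_diag_mx mul_mx_diag !mxE.
have [->|/gA] := eqVneq ((A a b)@_0) 0; first by rewrite mulr0 mul0r.
by rewrite mdeg0 add0n => <-; rewrite mulrC.
Qed.

Lemma rank_part_mx r (d : 'I_r -> nat) j :
  \rank (part_mx d j) = #|[set a | d a == j]|.
Proof.
have -> : \rank (part_mx d j) =
    \rank (\sum_(a | d a == j) <<delta_mx 0 a : 'rV[K]_r>>)%MS.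
  apply/eqmx_rank/andP; split.
    apply/row_subP => a; rewrite row_diag_mx mxE.
    case da: (d a == j); last by rewrite mulr0n scale0r sub0mx.
    by rewrite mulr1n scale1r (sumsmx_sup a) // genmxE.
  apply/sumsmx_subP => a da; rewrite genmxE.
  have -> : delta_mx 0 a = row a (part_mx d j).
    by rewrite row_diag_mx mxE da mulr1n scale1r.
  exact: row_sub.
have /mxdirectP -> /= := mxdirect_delta K (f := id) (P := fun a => d a == j)
  (in2W (@inj_id _)).
under eq_bigr do rewrite genmxE mxrank_delta.
by rewrite sum1_card cardsE.
Qed.

End Support.

(** * Betti numbers do not depend on the resolution *)
Section Resolutions.
Variables (K : fieldType) (N : nat) (J : {mpoly K[N]} -> Prop).
Local Notation S := {mpoly K[N]}.
Variable Q : 'X_{1..N} -> Prop.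
Hypothesis QD : forall m m', Q m -> Q (m + m')%MM.
Hypothesis JP : forall f, J f <-> forall m, f@_m != 0 -> Q m.

Section Lifting.
Variable F : graded_free_resolution J.
Local Notation deg i := (@gfr_deg K N J F i).
Local Notation d i := (gfr_diff F i).

Lemma gfr_diff_graded i : graded (deg i.+1) (deg i) (d i).
Proof.
move=> a b m nz; have [le|lt] := leqP (deg i b) (deg i.+1 a).
  have /dhomogP/(_ m) := gfr_diff_homog le.
  by rewrite mcoeff_msupp => /(_ nz) ->; rewrite subnK.
by rewrite gfr_diff_eq0 // mcoeff0 eqxx in nz.
Qed.

Lemma aug_graded : graded (deg 0%N) (fun=> 0%N) (gfr_aug F).
Proof.
move=> a b m; rewrite ord1 addn0 => nz; have /dhomogP := gfr_aug_homog a.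
by apply; rewrite mcoeff_msupp.
Qed.

(** Making the augmentation the differential out of degree 0 lets exactness be
    stated once for all degrees. *)
Definition cycle i : 'rV[S]_(gfr_rank F i) -> Prop :=
  match i return 'rV[S]_(gfr_rank F i) -> Prop with
  | 0 => fun v => J ((v *m gfr_aug F) 0 0)
  | i'.+1 => fun v => v *m d i' = 0
  end.

Lemma cycleP i (v : 'rV[S]_(gfr_rank F i)) :
  cycle v <-> exists w, v = w *m d i.
Proof. by case: i v => [|i] v; [apply: gfr_aug_exact|apply: gfr_diff_exact]. Qed.

(** Graded projectivity: a graded map from a free module into the cycles lifts
    through the next differential. *)
Lemma cycle_lift r (dr : 'I_r -> nat) i (M : 'M[S]_(r, gfr_rank F i)) :
  graded dr (deg i) M -> (forall a, cycle (row a M)) ->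
  exists2 W, graded dr (deg i.+1) W & M = W *m d i.
Proof.
move=> gM cM.
have /boolp.choice[w wP] a : exists w, row a M = w *m d i by apply/cycleP.
pose W0 := \matrix_a w a.
exists (graded_part dr (deg i.+1) W0); first exact: graded_partP.
rewrite -(graded_part_mul _ _ (@gfr_diff_graded i)).
suff -> : W0 *m d i = M by rewrite graded_part_id.
by apply/row_matrixP => a; rewrite row_mul rowK -wP.
Qed.

Lemma cycle_row r i (M : 'M[S]_(r, gfr_rank F i)) :
  (forall v, cycle (v *m M)) -> forall a, cycle (row a M).
Proof. by move=> cM a; rewrite rowE; apply: cM. Qed.

Lemma diff_diff i : d i.+1 *m d i = 0.
Proof.
apply/row_matrixP => a; rewrite row_mul row0.
by have /(cycleP (i:=i.+1)) : exists w, row a (d i.+1) = w *m d i.+1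
  by exists (delta_mx 0 a); rewrite rowE.
Qed.

(** A chain map which vanishes on the resolved module is null-homotopic.  The
    invariant kept while choosing h_i is that f_i - h_i d_i kills the image of
    the incoming differential, which is what makes f_(i+1) - d_i h_i a matrix of
    cycles and so provides h_(i+1). *)
Lemma homotopy (f : forall i, 'M[S]_(gfr_rank F i)) :
  (forall i, graded (deg i) (deg i) (f i)) ->
  (forall i, d i *m f i = f i.+1 *m d i) ->
  (forall v, cycle (i:=0) (v *m f 0%N)) ->
  exists h : forall i, 'M[S]_(gfr_rank F i, gfr_rank F i.+1),
    (forall i, graded (deg i) (deg i.+1) (h i)) /\
    (forall i, f i.+1 = d i *m h i + h i.+1 *m d i.+1).
Proof.
move=> gf fC f0.
pose P i (h : 'M[S]_(gfr_rank F i, gfr_rank F i.+1)) :=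
  graded (deg i) (deg i.+1) h /\ d i *m (f i - h *m d i) = 0.
pose R i (h : 'M[S]_(gfr_rank F i, gfr_rank F i.+1))
  (h' : 'M[S]_(gfr_rank F i.+1, gfr_rank F i.+2)) :=
  f i.+1 = d i *m h + h' *m d i.+1.
have [||h [Ph Rh]] := @dependent_choice _ P R.
- have [h gh e] := cycle_lift (gf 0%N) (cycle_row f0).
  by exists h; split=> //; rewrite -e subrr mulmx0.
- move=> i h [gh eh].
  have gM : graded (deg i.+1) (deg i.+1) (f i.+1 - d i *m h).
    by apply: gradedB => //; apply: graded_mul gh; apply: gfr_diff_graded.
  have cM v : cycle (i:=i.+1) (v *m (f i.+1 - d i *m h)).
    rewrite /= -mulmxA mulmxBl -fC -mulmxA -mulmxBr.
    by rewrite eh mulmx0.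
  have [h' gh' e] := cycle_lift gM (cycle_row cM).
  exists h'; last by rewrite /R -e addrC subrK.
  by split=> //; rewrite -e opprB addrC subrK mulmxA diff_diff mul0mx.
- by exists h; split=> [i|i]; [case: (Ph i)|apply: Rh].
Qed.

End Lifting.

Lemma mem_add f g : J f -> J g -> J (f + g).
Proof.
move=> /JP Jf /JP Jg; apply/JP => m; rewrite mcoeffD => nz.
have [/eqP f0|/Jf//] := boolP (f@_m == 0).
by apply: Jg; apply: contraNneq nz => g0; rewrite f0 g0 addr0.
Qed.

Lemma mem_mul f g : J g -> J (f * g).
Proof.
move=> /JP Jg; apply/JP => m nz.
have : ((f%:M *m g%:M : 'M[S]_1) 0 0)@_m != 0 by rewrite -scalar_mxM mxE mulr1n.
move=> /mulmx_coeff_neq0[b [m1 [m2 [-> _]]]].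
by rewrite ord1 mxE mulr1n => /Jg; rewrite addmC; apply: QD.
Qed.

Lemma mem_mulmx r (v : 'rV[S]_r) (A : 'cV[S]_r) :
  (forall a, J (A a 0)) -> J ((v *m A) 0 0).
Proof.
move=> JA; rewrite mxE; elim/big_ind: _ => [|f g|a _].
- by apply/JP => m; rewrite mcoeff0 eqxx.
- exact: mem_add.
- exact: mem_mul.
Qed.

(** The identity of S/J lifts to a graded chain map between any two of its
    resolutions. *)
Lemma comparison (F G : graded_free_resolution J) :
  exists f : forall i, 'M[S]_(gfr_rank F i, gfr_rank G i),
  [/\ forall i, graded (@gfr_deg _ _ _ F i) (@gfr_deg _ _ _ G i) (f i),
      forall v : 'rV_(gfr_rank F 0), J ((v *m (f 0%N *m gfr_aug G - gfr_aug F)) 0 0) &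
      forall i, gfr_diff F i *m f i = f i.+1 *m gfr_diff G i].
Proof.
pose T i := 'M[S]_(gfr_rank F i, gfr_rank G i).
pose P i (f : T i) :=
  graded (@gfr_deg _ _ _ F i) (@gfr_deg _ _ _ G i) f /\
  (match i return T i -> Prop with
   | 0 => fun f => forall v : 'rV_(gfr_rank F 0),
                     J ((v *m (f *m gfr_aug G - gfr_aug F)) 0 0)
   | _ => fun=> True
   end f) /\ forall v, cycle v -> cycle (v *m f).
pose R i (f : T i) (f' : T i.+1) :=
  gfr_diff F i *m f = f' *m gfr_diff G i.
have [w wP] : exists w : T 0%N, forall a, J ((w *m gfr_aug G - gfr_aug F) a 0).
  have /boolp.choice[w wP] a := gfr_aug_surj G (gfr_aug F a 0).
  exists (\matrix_a w a) => a; have := mem_mul (-1) (wP a).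
  rewrite mulN1r opprB; congr J.
  rewrite !mxE; congr (_ - _).
  by apply: eq_bigr => b _; rewrite mxE.
pose f0 : T 0%N := graded_part (@gfr_deg _ _ _ F 0) (@gfr_deg _ _ _ G 0) w.
have f0P (v : 'rV_(gfr_rank F 0)) : J ((v *m (f0 *m gfr_aug G - gfr_aug F)) 0 0).
  apply: mem_mulmx => a.
  rewrite -(graded_part_id (@aug_graded F)) -(graded_part_mul _ _ (@aug_graded G)).
  rewrite -graded_partB mxE; apply/JP => m.
  by rewrite mcoeff_mfilter; case: ifP => [_|]; [have /JP := wP a; apply|rewrite eqxx].
have [||f [Pf Rf]] := @dependent_choice T P R.
- exists f0; split=> [|]; first exact: graded_partP.
  split=> // v cv.
  rewrite /cycle; have := mem_add (f0P v) cv.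
  by rewrite mulmxBr mulmxA mxE [X in _ + X + _]mxE subrK.
- move=> i f [gf [_ cf]].
  have gM : graded (@gfr_deg _ _ _ F i.+1) (@gfr_deg _ _ _ G i) (gfr_diff F i *m f).
    exact: graded_mul (@gfr_diff_graded F i) gf.
  have cM v : cycle (v *m (gfr_diff F i *m f)).
    by rewrite mulmxA; apply: cf; apply/cycleP; exists v.
  have [f' gf' e] := cycle_lift gM (cycle_row cM).
  exists f' => //; split=> //; split=> // v cv.
  by rewrite /= -mulmxA -e mulmxA cv mul0mx.
- exists f; split=> [i||//]; first by case: (Pf i).
  by case: (Pf 0%N) => _ [].
Qed.

(** The two comparison maps f : F -> G and g : G -> F are inverse to each other
    up to homotopy.  Over the residue field the differentials of the minimal
    resolution G vanish, so g f becomes the identity there; hence f maps the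
    degree j cycles of F onto the whole degree j part of G, and its kernel on
    these cycles consists of boundaries because 1 - f g is null-homotopic.  The
    rank formula for f then counts the generators of G. *)
Theorem betti_minimal (F G : graded_free_resolution J) i j :
  (forall i, fibre_diff G i = 0) ->
  betti F i.+1 j = #|[set a | gfr_deg (g:=G) (i:=i.+1) a == j]|.
Proof.
move=> minG.
have [f [gf f0 fC]] := comparison F G.
have [g [gg g0 gC]] := comparison G F.
have dd (H : graded_free_resolution J) l :
    at0 (gfr_diff H l.+1) *m at0 (gfr_diff H l) = 0.
  by rewrite -at0M diff_diff; apply/matrixP => a b; rewrite !mxE mcoeff0.
have addE (A B : 'M[S]_1) : A 0 0 + B 0 0 = (A + B) 0 0 by rewrite mxE.
have dG0 l : at0 (gfr_diff G l) = 0 by apply: minG.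
have [h [gh hE]] : exists h : forall i, 'M[S]_(gfr_rank F i, gfr_rank F i.+1),
    (forall i, graded (@gfr_deg _ _ _ F i) (@gfr_deg _ _ _ F i.+1) (h i)) /\
    (forall i, f i.+1 *m g i.+1 - 1%:M
       = gfr_diff F i *m h i + h i.+1 *m gfr_diff F i.+1).
  apply: (homotopy (f := fun i => f i *m g i - 1%:M)) => [l|l|v].
  - exact: gradedB (graded_mul (gf l) (gg l)) (@graded1 _ _ _ _).
  - by rewrite mulmxBr mulmxBl mulmx1 mul1mx mulmxA fC -!mulmxA gC.
  - rewrite /= -[v *m _ *m _]mulmxA mulmxBl mul1mx.
    have := mem_add (g0 (v *m f 0%N)) (f0 v).
    by rewrite addE !mulmxBr !mulmxA addrA subrK.
have [h' [gh' hE']] : exists h : forall i, 'M[S]_(gfr_rank G i, gfr_rank G i.+1),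
    (forall i, graded (@gfr_deg _ _ _ G i) (@gfr_deg _ _ _ G i.+1) (h i)) /\
    (forall i, g i.+1 *m f i.+1 - 1%:M
       = gfr_diff G i *m h i + h i.+1 *m gfr_diff G i.+1).
  apply: (homotopy (f := fun i => g i *m f i - 1%:M)) => [l|l|w].
  - exact: gradedB (graded_mul (gg l) (gf l)) (@graded1 _ _ _ _).
  - by rewrite mulmxBr mulmxBl mulmx1 mul1mx mulmxA gC -!mulmxA fC.
  - rewrite /= -[w *m _ *m _]mulmxA mulmxBl mul1mx.
    have := mem_add (f0 (w *m g 0%N)) (g0 w).
    by rewrite addE !mulmxBr !mulmxA addrA subrK.
have gf1 : at0 (g i.+1) *m at0 (f i.+1) = 1%:M.
  apply/eqP; rewrite -subr_eq0 -at0M -(at01 K N) -at0B hE' at0D !at0M !dG0.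
  by rewrite mul0mx mulmx0 addr0.
have fgE : at0 (f i.+1) *m at0 (g i.+1) - 1%:M =
    at0 (gfr_diff F i) *m at0 (h i) + at0 (h i.+1) *m at0 (gfr_diff F i.+1).
  by rewrite -at0M -(at01 K N) -at0B hE at0D !at0M.
rewrite /betti /= -/(at0 (gfr_diff F i)).
set Z := (_ :&: _)%MS; set B := fibre_boundaries _ _ _.
pose pF l := part_mx K (@gfr_deg _ _ _ F l) j.
pose pG l := part_mx K (@gfr_deg _ _ _ G l) j.
have Zp : (Z <= pF i.+1)%MS by apply: capmxSl.
have eZ : (Z *m at0 (f i.+1) :=: pG i.+1)%MS.
  apply/eqmxP/andP; split.
    apply: submx_trans (submxMr _ Zp) _.
    by rewrite (part_mxC _ (gf i.+1)) submxMl.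
  rewrite -[pG i.+1]mulmx1 -gf1 mulmxA submxMr // sub_capmx.
  apply/andP; split; first by rewrite (part_mxC _ (gg i.+1)) submxMl.
  apply/sub_kermxP.
  by rewrite -mulmxA -at0M -gC at0M dG0 mul0mx mulmx0.
have eB : (Z :&: kermx (at0 (f i.+1)) :=: B)%MS.
  apply/eqmxP/andP; split; last first.
    rewrite /Z !sub_capmx /B /fibre_boundaries -andbA; apply/and3P; split.
    - by rewrite (part_mxC _ (@gfr_diff_graded F i.+1)) submxMl.
    - by apply/sub_kermxP; rewrite -mulmxA [X in _ *m X]dd mulmx0.
    - apply/sub_kermxP; rewrite -mulmxA -[fibre_diff F i.+1]/(at0 (gfr_diff F i.+1)).
      by rewrite -at0M fC at0M dG0 !mulmx0.
  set A := (_ :&: _)%MS.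
  have Ap : (A <= pF i.+1)%MS by apply: submx_trans (capmxSl _ _) Zp.
  have Ad : A *m at0 (gfr_diff F i) = 0.
    apply/sub_kermxP; apply: submx_trans (capmxSl _ _) _; exact: capmxSr.
  have Af : A *m at0 (f i.+1) = 0 by apply/sub_kermxP; apply: capmxSr.
  have -> : A = - (A *m (at0 (f i.+1) *m at0 (g i.+1) - 1%:M)).
    by rewrite mulmxBr mulmxA Af mul0mx mulmx1 sub0r opprK.
  rewrite fgE mulmxDr mulmxA Ad mul0mx add0r eqmx_opp.
  have /submxP[A' ->] := Ap.
  by rewrite !mulmxA -(mulmxA A') (part_mxC _ (gh i.+1)) mulmxA -mulmxA submxMl.
rewrite -(mxrank_mul_ker Z (at0 (f i.+1))) eZ eB addnK.
exact: rank_part_mx.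
Qed.
End Resolutions.

(** * Multigraded complexes as matrices over the field *)
Section Frames.
Variables (K : fieldType) (E : finType).

(** The degree sg strand of a multigraded free module is spanned by the basis
    vectors whose squarefree multidegree divides sg. *)
Definition within r (s : 'I_r -> {set E}) (sg : {set E}) (v : 'rV[K]_r) :=
  forall a, v 0 a != 0 -> s a \subset sg.

Definition respects (R : rel {set E}) r c (s : 'I_r -> {set E})
    (t : 'I_c -> {set E}) (A : 'M[K]_(r, c)) :=
  forall a b, A a b != 0 -> R (t b) (s a).

Definition join_supp r1 r2 (s1 : 'I_r1 -> {set E}) (s2 : 'I_r2 -> {set E})
    (a : 'I_(r1 + r2)) : {set E} :=
  match split a with inl a1 => s1 a1 | inr a2 => s2 a2 end.

Lemma join_suppl r1 r2 (s1 : 'I_r1 -> {set E}) (s2 : 'I_r2 -> {set E}) a :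
  join_supp s1 s2 (lshift _ a) = s1 a.
Proof. by rewrite /join_supp (unsplitK (inl a)). Qed.

Lemma join_suppr r1 r2 (s1 : 'I_r1 -> {set E}) (s2 : 'I_r2 -> {set E}) a :
  join_supp s1 s2 (rshift _ a) = s2 a.
Proof. by rewrite /join_supp (unsplitK (inr a)). Qed.

Lemma join_suppP (P : {set E} -> Prop) r1 r2 (s1 : 'I_r1 -> {set E})
    (s2 : 'I_r2 -> {set E}) :
  (forall a, P (s1 a)) -> (forall a, P (s2 a)) -> forall a, P (join_supp s1 s2 a).
Proof. by move=> P1 P2 a; rewrite /join_supp; case: split. Qed.

Lemma within_row r1 r2 (s1 : 'I_r1 -> {set E}) (s2 : 'I_r2 -> {set E}) sg
    (v1 : 'rV_r1) (v2 : 'rV_r2) :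
  within (join_supp s1 s2) sg (row_mx v1 v2) <->
  within s1 sg v1 /\ within s2 sg v2.
Proof.
split=> [h|[h1 h2] a].
  split=> a nz; first by have := h (lshift _ a); rewrite row_mxEl join_suppl; apply.
  by have := h (rshift _ a); rewrite row_mxEr join_suppr; apply.
rewrite -[a]splitK; case: (split a) => b /=.
  by rewrite row_mxEl join_suppl; apply: h1.
by rewrite row_mxEr join_suppr; apply: h2.
Qed.

Lemma respects_block (R : rel {set E}) r1 r2 c1 c2 (s1 : 'I_r1 -> {set E})
    (s2 : 'I_r2 -> {set E}) (t1 : 'I_c1 -> {set E}) (t2 : 'I_c2 -> {set E})
    A11 A12 A21 A22 :
  respects R s1 t1 A11 -> respects R s1 t2 A12 ->
  respects R s2 t1 A21 -> respects R s2 t2 A22 ->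
  respects R (join_supp s1 s2) (join_supp t1 t2) (block_mx A11 A12 A21 A22).
Proof.
move=> h1 h2 h3 h4 a b.
rewrite -[a]splitK -[b]splitK; case: (split a) (split b) => [a'|a'] [b'|b'] /=;
  rewrite ?join_suppl ?join_suppr.
- by rewrite block_mxEul; apply: h1.
- by rewrite block_mxEur; apply: h2.
- by rewrite block_mxEdl; apply: h3.
- by rewrite block_mxEdr; apply: h4.
Qed.

Lemma respects_col (R : rel {set E}) r1 r2 c (s1 : 'I_r1 -> {set E})
    (s2 : 'I_r2 -> {set E}) (t : 'I_c -> {set E}) A1 A2 :
  respects R s1 t A1 -> respects R s2 t A2 ->
  respects R (join_supp s1 s2) t (col_mx A1 A2).
Proof.
move=> h1 h2 a b; rewrite -[a]splitK; case: (split a) => a' /=;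
  rewrite ?join_suppl ?join_suppr.
- by rewrite col_mxEu; apply: h1.
- by rewrite col_mxEd; apply: h2.
Qed.

Lemma respects0 R r c (s : 'I_r -> {set E}) (t : 'I_c -> {set E}) :
  respects R s t 0.
Proof. by move=> a b; rewrite mxE eqxx. Qed.

Lemma respectsN R r c (s : 'I_r -> {set E}) (t : 'I_c -> {set E}) A :
  respects R s t A -> respects R s t (- A).
Proof. by move=> h a b; rewrite mxE oppr_eq0; apply: h. Qed.

Lemma within_mul r c (s : 'I_r -> {set E}) (t : 'I_c -> {set E}) A sg v :
  respects (fun x y => x \subset y) s t A -> within s sg v ->
  within t sg (v *m A).
Proof.
move=> hA hv b; rewrite mxE => nz.
have [a] : exists a, v 0 a * A a b != 0.
  apply/existsP; apply: contraNT nz => /existsPn h.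
  by rewrite big1 // => a _; apply/eqP; have := h a; rewrite negbK.
rewrite mulf_eq0 negb_or => /andP[/hv va /hA]; move=> /subset_trans; exact.
Qed.

Lemma withinD r (s : 'I_r -> {set E}) sg v w :
  within s sg v -> within s sg w -> within s sg (v + w).
Proof.
move=> hv hw a; rewrite mxE => nz; have [v0|/hv//] := eqVneq (v 0 a) 0.
by apply: hw; apply: contraNneq nz => ->; rewrite v0 addr0.
Qed.

Lemma within0 r (s : 'I_r -> {set E}) sg : within s sg 0.
Proof. by move=> a; rewrite mxE eqxx. Qed.

Lemma withinZ r (s : 'I_r -> {set E}) sg c v :
  within s sg v -> within s sg (c *: v).
Proof. by move=> hv a; rewrite mxE mulf_eq0 negb_or => /andP[_]; apply: hv. Qed.

(** As for resolutions, the augmentation is treated as the differential out of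
    homological degree 0. *)
Definition frame_cycle (rk : nat -> nat) (D : forall i, 'M[K]_(rk i.+1, rk i))
    (aug : 'cV[K]_(rk 0%N)) i : 'rV[K]_(rk i) -> Prop :=
  match i return 'rV[K]_(rk i) -> Prop with
  | 0 => fun v => v *m aug = 0
  | i'.+1 => fun v => v *m D i' = 0
  end.

(** A multigraded free resolution of a squarefree monomial ideal is determined
    by scalar matrices: an entry between basis vectors of multidegrees s and t
    is a scalar times the monomial of s - t.  Exactness can be tested in each
    multidegree, and since all multidegrees are squarefree only the support sg
    of a monomial matters.  Strict inclusion in [fr_diff_supp] is minimality.
    The ideal is given by the set of supports of its monomials, and the ideal
    itself, rather than the quotient by it, is resolved. *)
Record frame (I : {set E} -> Prop) := Frame {
  fr_rank : nat -> nat;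
  fr_supp : forall i, 'I_(fr_rank i) -> {set E};
  fr_diff : forall i, 'M[K]_(fr_rank i.+1, fr_rank i);
  fr_aug : 'cV[K]_(fr_rank 0);
  fr_diff_supp : forall i,
    respects (fun x y => x \proper y) (@fr_supp i.+1) (@fr_supp i) (fr_diff i);
  fr_aug_supp : forall a, I (@fr_supp 0 a);
  fr_surj : forall sg, I sg ->
    exists2 v, within (@fr_supp 0) sg v & v *m fr_aug = 1%:M;
  fr_complex : forall i (w : 'rV_(fr_rank i.+1)),
    frame_cycle fr_diff fr_aug (w *m fr_diff i);
  fr_exact : forall sg i (v : 'rV_(fr_rank i)), within (@fr_supp i) sg v ->
    frame_cycle fr_diff fr_aug v ->
    exists2 w, within (@fr_supp i.+1) sg w & v = w *m fr_diff i
}.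

Definition fcycle I (A : frame I) i (v : 'rV_(fr_rank A i)) :=
  frame_cycle (fr_diff A) (fr_aug A) v.

Lemma fr_diff_sub I (A : frame I) i :
  respects (fun x y => x \subset y) (@fr_supp _ A i.+1) (@fr_supp _ A i) (fr_diff A i).
Proof. by move=> a b /fr_diff_supp/proper_sub. Qed.

(** An inclusion of ideals lifts to their resolutions.  Exactness is applied in
    the multidegree of each basis vector, which keeps the lift multigraded. *)
Lemma frame_lift (I M : {set E} -> Prop) (A : frame I) (B : frame M) :
  (forall sg, M sg -> I sg) ->
  exists f : forall i, 'M[K]_(fr_rank B i, fr_rank A i),
  [/\ forall i, respects (fun x y => x \subset y)
                  (@fr_supp _ B i) (@fr_supp _ A i) (f i),
      f 0%N *m fr_aug A = fr_aug B &
      forall i, fr_diff B i *m f i = f i.+1 *m fr_diff A i].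
Proof.
move=> MI.
pose T i := 'M[K]_(fr_rank B i, fr_rank A i).
pose P i (f : T i) :=
  [/\ respects (fun x y => x \subset y) (@fr_supp _ B i) (@fr_supp _ A i) f,
   match i return T i -> Prop with
   | 0 => fun f => f *m fr_aug A = fr_aug B
   | _ => fun=> True
   end f & forall v, fcycle v -> fcycle (v *m f)].
pose R i (f : T i) (f' : T i.+1) := fr_diff B i *m f = f' *m fr_diff A i.
have [||f [Pf Rf]] := @dependent_choice T P R.
- have /boolp.choice[w wP] b : exists w, within (@fr_supp _ A 0) (fr_supp b) w /\
      w *m fr_aug A = (fr_aug B b 0)%:M.
    have [v v1 v2] := fr_surj A (MI _ (fr_aug_supp b)).
    exists (fr_aug B b 0 *: v); split; first exact: withinZ.
    by rewrite -scalemxAl v2 scalemx1.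
  have e : (\matrix_b w b) *m fr_aug A = fr_aug B.
    apply/row_matrixP => b; rewrite row_mul rowK (wP b).2.
    by apply/matrixP => x y; rewrite !mxE !ord1.
  exists (\matrix_b w b); split=> //.
    by move=> b a; rewrite mxE; apply: (wP b).1.
  by move=> v; rewrite /fcycle /= -mulmxA e.
- move=> i f [sf _ cf].
  have /boolp.choice[w wP] b : exists w, within (@fr_supp _ A i.+1) (fr_supp b) w /\
      row b (fr_diff B i *m f) = w *m fr_diff A i.
    have [||w w1 w2] := @fr_exact _ A (fr_supp b) i (row b (fr_diff B i *m f)).
    - rewrite row_mul; apply: within_mul sf _ => c.
      by rewrite mxE => /fr_diff_sub.
    - by rewrite row_mul; apply: cf; rewrite rowE; apply: fr_complex.
    - by exists w.
  have e : R i f (\matrix_b w b).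
    by apply/row_matrixP => b; rewrite [RHS]row_mul rowK (wP b).2.
  exists (\matrix_b w b) => //; split=> //.
    by move=> b a; rewrite mxE; apply: (wP b).1.
  by move=> v; rewrite /fcycle /= -mulmxA -e mulmxA => ->; rewrite mul0mx.
- exists f; split=> [i||//]; first by case: (Pf i).
  by case: (Pf 0%N).
Qed.

(** * Mapping cones *)
Section Cone.
Variables (I M : {set E} -> Prop) (A : frame I) (B : frame M) (e : E).
Hypothesis MI : forall sg, M sg -> I sg.
Hypothesis I_up : forall sg tau : {set E}, sg \subset tau -> I sg -> I tau.
Hypothesis eA : forall i a, e \notin @fr_supp _ A i a.
Hypothesis eB : forall i b, e \notin @fr_supp _ B i b.
Hypothesis ABdisj : forall i a b, @fr_supp _ A i a <> @fr_supp _ B i b.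
Variable f : forall i, 'M[K]_(fr_rank B i, fr_rank A i).
Hypothesis f_supp : forall i, respects (fun x y => x \subset y)
  (@fr_supp _ B i) (@fr_supp _ A i) (f i).
Hypothesis f_aug : f 0%N *m fr_aug A = fr_aug B.
Hypothesis f_diff : forall i, fr_diff B i *m f i = f i.+1 *m fr_diff A i.

(** The supports of the monomials of x_e I + M. *)
Definition cone_ideal (sg : {set E}) := (e \in sg /\ I sg) \/ M sg.

(** The copy of B shifted by one homological degree and multiplied by x_e; it
    has nothing in homological degree 0. *)
Definition shift_rank i := if i is i'.+1 then fr_rank B i' else 0%N.

Definition shift_supp i : 'I_(shift_rank i) -> {set E} :=
  match i return 'I_(shift_rank i) -> {set E} with
  | 0 => fun=> set0
  | i'.+1 => fun b => e |: fr_supp b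
  end.

Definition shift_diff i : 'M[K]_(shift_rank i.+1, shift_rank i) :=
  match i return 'M[K]_(shift_rank i.+1, shift_rank i) with
  | 0 => 0
  | i'.+1 => - fr_diff B i'
  end.

Definition cone_rank i := (fr_rank A i + (fr_rank B i + shift_rank i))%N.

Definition cone_supp i : 'I_(cone_rank i) -> {set E} :=
  join_supp (fun a => e |: @fr_supp _ A i a)
    (join_supp (@fr_supp _ B i) (@shift_supp i)).

(** The kernel of I (+) M -> x_e I + M, (a, b) |-> x_e a + b, is M embedded by
    m |-> (m, - x_e m).  This is the cone of a lift of that embedding: f into the
    A part, and - x_e, whose scalar is - 1, into the B part. *)
Definition cone_diff i : 'M[K]_(cone_rank i.+1, cone_rank i) :=
  block_mx (fr_diff A i) 0 (col_mx 0 (f i))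
    (block_mx (fr_diff B i) 0 (- 1%:M) (shift_diff i)).

Definition cone_aug : 'cV[K]_(cone_rank 0) :=
  col_mx (fr_aug A) (col_mx (fr_aug B) 0).

Lemma cone_diff_row i (a : 'rV_(fr_rank A i.+1)) (b : 'rV_(fr_rank B i.+1))
    (c : 'rV_(fr_rank B i)) :
  row_mx a (row_mx b c) *m cone_diff i =
  row_mx (a *m fr_diff A i + c *m f i)
    (row_mx (b *m fr_diff B i - c) (c *m shift_diff i)).
Proof.
rewrite /cone_diff (mul_row_block a) mulmx0 mul_row_col mulmx0 add0r.
by rewrite (mul_row_block b) mulmx0 mulmxN mulmx1 add0r add0r.
Qed.

Lemma shift_diff_diff i : shift_diff i.+1 *m shift_diff i = 0.
Proof.
case: i => [|i]; first by rewrite mulmx0.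
rewrite /= mulmxN mulNmx opprK; apply/row_matrixP => b.
by rewrite row_mul row0 rowE; apply: (@fr_complex _ B i.+1).
Qed.

Lemma proper_setU1 (x y : {set E}) :
  e \notin x -> e \notin y -> x \proper y -> (e |: x) \proper (e |: y).
Proof.
move=> ex ey /properP[sxy [z zy zx]]; apply/properP; split; first exact: setUS.
exists z; first by rewrite inE zy orbT.
by rewrite !inE negb_or zx andbT; apply: contraNneq ey => <-.
Qed.

(** Minimality of the cone.  The entries of f are the only ones in doubt: a
    nonzero entry at equal multidegrees would be a unit, and [ABdisj] excludes
    it. *)
Lemma cone_diff_supp i : respects (fun x y => x \proper y)
  (@cone_supp i.+1) (@cone_supp i) (cone_diff i).
Proof.
apply: respects_block; last apply: respects_block.
- by move=> a b /fr_diff_supp; apply: proper_setU1.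
- exact: respects0.
- apply: respects_col; first exact: respects0.
  move=> b a /f_supp sab; apply: proper_setU1 => //.
  by rewrite properEneq sab andbT; apply/eqP/ABdisj.
- exact: fr_diff_supp.
- exact: respects0.
- apply: respectsN => a b; rewrite mxE;
  case: (eqVneq a b) => [->|_]; last by rewrite eqxx.
  by move=> _; rewrite properUr // sub1set eB.
- case: i => [|i] /=; first exact: respects0.
  by apply: respectsN => a b /fr_diff_supp; apply: proper_setU1.
Qed.

Lemma cone_aug_supp a : cone_ideal (@cone_supp 0 a).
Proof.
apply: join_suppP a => [a|].
  by left; split; [rewrite setU11|apply: I_up (fr_aug_supp a); apply: subsetUr].
by apply: join_suppP => [b|[]//]; right; apply: fr_aug_supp.
Qed.

Lemma cone_surj sg : cone_ideal sg ->
  exists2 v, within (@cone_supp 0) sg v & v *m cone_aug = 1%:M.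
Proof.
case=> [[esg /(fr_surj A)[v v1 v2]]|/(fr_surj B)[v v1 v2]].
  exists (row_mx v 0); last by rewrite mul_row_col v2 mul0mx addr0.
  apply/within_row; split; last exact: within0.
  by move=> a /v1 h; rewrite subUset sub1set esg.
exists (row_mx 0 (row_mx v 0)).
  apply/within_row; split; first exact: within0.
  by apply/within_row; split=> //; apply: within0.
by rewrite !mul_row_col v2 !mul0mx addr0 add0r.
Qed.

Lemma cone_complex i (w : 'rV_(cone_rank i.+1)) :
  frame_cycle cone_diff cone_aug (w *m cone_diff i).
Proof.
rewrite -[w]hsubmxK -[rsubmx w]hsubmxK.
move: (lsubmx w) (lsubmx (rsubmx w)) (rsubmx (rsubmx w)) => a b c.
rewrite cone_diff_row.
have cA := @fr_complex _ A i a; have cB := @fr_complex _ B i b.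
case: i w a b c cA cB => [|i] w a b c cA cB.
  rewrite /= !mul_row_col mulmx0 addr0 mulmxDl [_ *m fr_diff A _ *m _]cA add0r.
  by rewrite mulmxBl [_ *m fr_diff B _ *m _]cB sub0r -mulmxA f_aug subrr.
rewrite /frame_cycle cone_diff_row -[RHS]row_mx0 -[in X in _ = row_mx _ X]row_mx0.
congr row_mx; [|congr row_mx].
- rewrite mulmxDl [_ *m fr_diff A _ *m _]cA add0r -mulmxA -f_diff.
  by rewrite /= mulmxN mulNmx mulmxA subrr.
- by rewrite mulmxBl [_ *m fr_diff B _ *m _]cB sub0r /= mulmxN opprK addrC subrr.
- by rewrite -mulmxA shift_diff_diff mulmx0.
Qed.

(** If e is not in sg, only the unshifted copy of B meets the strand, and B is
    exact.  If e is in sg, both copies of B appear in full because no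
    multidegree of B contains e; subtracting the boundary of - b in the shifted
    copy cancels them against each other and leaves the cycle a + b f of A. *)
Lemma cone_exact sg i (v : 'rV_(cone_rank i)) : within (@cone_supp i) sg v ->
  frame_cycle cone_diff cone_aug v ->
  exists2 w, within (@cone_supp i.+1) sg w & v = w *m cone_diff i.
Proof.
rewrite -[v]hsubmxK -[rsubmx v]hsubmxK.
move: (lsubmx v) (lsubmx (rsubmx v)) (rsubmx (rsubmx v)) => a b c {v}.
move=> /within_row[wa /within_row[wb wc]] cyc.
have wa' : within (@fr_supp _ A i) sg a.
  by move=> x /wa; rewrite subUset => /andP[].
have [esg|esg] := boolP (e \in sg).
  have ec : c = - b *m shift_diff i.
    case: i a b c {wa wb wc wa'} cyc => [|i] a b c /=.
      by move=> _; apply/matrixP => x [].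
    rewrite cone_diff_row -row_mx0 => /eq_row_mx[_].
    rewrite -row_mx0 => /eq_row_mx[/eqP + _].
    by rewrite subr_eq0 mulmxN mulNmx opprK => /eqP.
  have [||wA wA1 wA2] := @fr_exact _ A sg i (a + b *m f i).
  - by apply: withinD => //; apply: within_mul wb.
  - case: i a b c {wa wb wc wa'} cyc ec => [|i] a b c /=.
      by rewrite !mul_row_col mulmx0 addr0 mulmxDl -mulmxA f_aug.
    rewrite cone_diff_row -row_mx0 => /eq_row_mx[+ _] ec.
    have {ec}-> : c = b *m fr_diff B i by rewrite ec mulmxN mulNmx opprK.
    by rewrite mulmxDl -[b *m f _ *m _]mulmxA -f_diff mulmxA.
  exists (row_mx wA (row_mx 0 (- b))).
    apply/within_row; split; first by move=> x /wA1; rewrite subUset sub1set esg.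
    apply/within_row; split; first exact: within0.
    by move=> x; rewrite mxE oppr_eq0 => /wb; rewrite /= subUset sub1set esg.
  by rewrite cone_diff_row -wA2 mulNmx addrK mul0mx sub0r opprK -ec.
have a0 : a = 0.
  apply/rowP => x; rewrite mxE; apply/eqP; apply: contraNT esg => /wa.
  by rewrite subUset sub1set => /andP[].
have c0 : c = 0.
  case: i a b c {wa wb wa' a0 cyc} wc => [|i] a b c wc; apply/rowP => x.
    by case: x.
  rewrite mxE; apply/eqP; apply: contraNT esg => /wc.
  by rewrite /= subUset sub1set => /andP[].
have [//||wB wB1 wB2] := @fr_exact _ B sg i b.
  move: cyc; rewrite a0 c0; case: i a b c {wa wb wc wa' a0 c0} => [|i] a b c /=.
    by rewrite !mul_row_col !mul0mx add0r addr0.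
  rewrite cone_diff_row -row_mx0 => /eq_row_mx[_].
  by rewrite -row_mx0 => /eq_row_mx[+ _]; rewrite subr0.
exists (row_mx 0 (row_mx wB 0)).
  apply/within_row; split; first exact: within0.
  by apply/within_row; split=> //; apply: within0.
by rewrite cone_diff_row !mul0mx addr0 subr0 a0 c0 -wB2.
Qed.

Definition cone_frame : frame cone_ideal :=
  @Frame _ _ cone_supp cone_diff cone_aug cone_diff_supp cone_aug_supp
    cone_surj cone_complex cone_exact.

End Cone.

End Frames.

(** * Resolutions of the cut ideals of forests *)
Section Generating.
Variables (K : fieldType) (E : finType) (R : comNzRingType) (t : R).

Definition fr_gen (I : {set E} -> Prop) (A : frame K I) i : R :=
  \sum_(a < fr_rank A i) t ^+ #|@fr_supp _ _ _ A i a|.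

(** Changing the description of the ideal leaves the complex unchanged; the
    first clause transfers what is known about the multidegrees. *)
Lemma frame_iff (I I' : {set E} -> Prop) (A : frame K I) :
  (forall sg, I sg <-> I' sg) -> exists B : frame K I',
  (forall (P : {set E} -> Prop), (forall i a, P (@fr_supp _ _ _ A i a)) ->
     forall i a, P (@fr_supp _ _ _ B i a)) /\
  (forall i, fr_gen B i = fr_gen A i).
Proof.
move=> II'; unshelve eexists.
  apply: (@Frame K E I' _ (@fr_supp _ _ _ A) (fr_diff A) (fr_aug A)
    (@fr_diff_supp _ _ _ A) _ _ (@fr_complex _ _ _ A) (@fr_exact _ _ _ A)).
  - by move=> a; apply/II'; apply: fr_aug_supp.
  - by move=> sg /II'/fr_surj; apply.
by split.
Qed.

Lemma frame_empty : exists A : frame K (fun _ : {set E} => False),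
  forall i, fr_rank A i = 0%N.
Proof.
unshelve eexists.
  apply: (@Frame K E _ (fun=> 0%N) (fun=> fun=> set0) (fun=> 0) 0); try by [].
  - by move=> i [].
  - by move=> [].
  - by case=> [|i] a; rewrite mulmx0 /= ?mul0mx.
  - move=> sg i v _ _; exists 0; first exact: within0.
    by apply/rowP => -[].
by [].
Qed.

Lemma frame_unit : exists A : frame K (fun _ : {set E} => True),
  (forall i a, @fr_supp _ _ _ A i a = set0) /\
  (forall i, fr_gen A i = (i == 0%N)%:R).
Proof.
unshelve eexists.
  apply: (@Frame K E _ (fun i => (i == 0%N) : nat) (fun=> fun=> set0)
    (fun=> 0) 1%:M); try by [].
  - by move=> i a b; rewrite mxE eqxx.
  - move=> sg _; exists 1%:M; last by rewrite mulmx1.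
    by move=> a _; apply: sub0set.
  - by move=> [|i] a /=; rewrite ?mulmx0 ?mul0mx.
  - move=> sg [|i] v _ /= cv; exists 0; try exact: within0.
      by rewrite mulmx0 -cv mulmx1.
    by apply/rowP => -[].
split=> // i; rewrite /fr_gen /=; case: i => [|i] /=.
  by rewrite big_ord1 cards0 expr0.
by rewrite big_ord0.
Qed.

(** The cone with its lift chosen.  The first clause is the case analysis on
    the three kinds of generators, the second counts them. *)
Lemma frame_cone (I M : {set E} -> Prop) (A : frame K I) (B : frame K M) (e : E) :
  (forall sg, M sg -> I sg) ->
  (forall sg tau : {set E}, sg \subset tau -> I sg -> I tau) ->
  (forall i a, e \notin @fr_supp _ _ _ A i a) ->
  (forall i b, e \notin @fr_supp _ _ _ B i b) ->
  (forall i a b, @fr_supp _ _ _ A i a <> @fr_supp _ _ _ B i b) ->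
  exists C : frame K (cone_ideal I M e),
  (forall (P : {set E} -> Prop),
     (forall i a, P (e |: @fr_supp _ _ _ A i a)) ->
     (forall i b, P (@fr_supp _ _ _ B i b)) ->
     (forall i b, P (e |: @fr_supp _ _ _ B i b)) ->
     forall i c, P (@fr_supp _ _ _ C i c)) /\
  (forall i, fr_gen C i = t * fr_gen A i + fr_gen B i
     + (if i is i'.+1 then t * fr_gen B i' else 0)).
Proof.
move=> MI I_up eA eB dis; have [f [f1 f2 f3]] := frame_lift A B MI.
exists (cone_frame I_up eA eB dis f1 f2 f3); split=> [P PA PB PB' i c|i].
  do 2 ?[apply: join_suppP => {c}// c].
  by case: i c => [[]|].
rewrite /fr_gen /= /cone_supp big_split_ord /= -addrA; congr (_ + _).
  rewrite big_distrr /=; apply: eq_bigr => a _.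
  by rewrite join_suppl cardsU1 eA exprS.
rewrite big_split_ord /=; congr (_ + _).
  by apply: eq_bigr => b _; rewrite join_suppr join_suppl.
case: i => [|i] /=; first by rewrite big_ord0.
rewrite big_distrr /=; apply: eq_bigr => a _.
by rewrite !join_suppr /= cardsU1 eB exprS.
Qed.

End Generating.

Lemma prefix_total (T : eqType) (u v w : seq T) :
  prefix u w -> prefix v w -> prefix u v || prefix v u.
Proof.
move=> /prefixP[u' ->]; elim: u v => [|a u IH] [|b v] //=.
by case: eqP => //= -> h; rewrite eqxx /=; apply: IH.
Qed.

Section Forests.
Variables (K : fieldType) (k n : nat) (R : comNzRingType) (t : R).
Hypothesis k_gt0 : (0 < k)%N.
Local Notation E := (edge k n).
Implicit Types (u v : seq 'I_k) (F : seq (seq 'I_k)).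

Definition word (e : E) : seq 'I_k := val e.

Lemma word_inj : injective word.
Proof. by move=> e e' h; apply/val_inj/val_inj. Qed.

Lemma word_exists v : (0 < size v <= n)%N -> exists e, word e = v.
Proof.
move=> /andP[v0 vn]; have h : Bseq vn != [::] :> seq 'I_k by case: v v0 vn.
by exists (exist _ (Bseq vn) h).
Qed.

(** A forest is listed by the words naming the edges that its trees hang from;
    every path to a leaf that passes through one of them has to be cut at or
    below it. *)
Definition forest_cut F (sg : {set E}) : Prop :=
  forall v, v \in F -> forall w : n.-tuple 'I_k, prefix v w ->
  exists2 e, e \in sg & prefix v (word e) && prefix (word e) w.

Definition incomparable u v := ~~ prefix u v && ~~ prefix v u.

Definition antichain F :=
  all (fun v => 0 < size v <= n)%N F && pairwise incomparable F.

Definition children v := [seq rcons v c | c <- enum 'I_k].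

Lemma forest_cut_up F (sg tau : {set E}) :
  sg \subset tau -> forest_cut F sg -> forest_cut F tau.
Proof.
move=> st cF v vF w vw; have [e es h] := cF v vF w vw.
by exists e => //; apply: (subsetP st).
Qed.

(** A leaf has nothing below its edge, so the edge has to be cut: the second
    summand of the cone is the zero ideal. *)
Lemma forest_cut_leaf v F e sg : word e = v -> size v = n ->
  cone_ideal (forest_cut F) (fun=> False) e sg <-> forest_cut (v :: F) sg.
Proof.
move=> ev vn; split=> [[[es cF]|//] u|cF].
  rewrite inE => /predU1P[->|uF] w uw; last exact: cF.
  by exists e; rewrite // ev prefix_refl.
left; split; last by move=> u uF; apply: cF; rewrite inE uF orbT.
have [|e' es] := cF v (mem_head _ _) (tcast vn (in_tuple v)).
  by rewrite val_tcast prefix_refl.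
rewrite val_tcast -ev => /andP[p1 p2].
suff -> : e = e' by [].
apply: word_inj; move: p1; rewrite prefixE take_oversize ?size_prefix //.
by move/eqP.
Qed.

(** Either the edge of v is cut, or every path through v is cut strictly below
    v, hence at or below some child of v. *)
Lemma forest_cut_node v F e sg : word e = v -> (size v < n)%N ->
  cone_ideal (forest_cut F) (forest_cut (children v ++ F)) e sg
  <-> forest_cut (v :: F) sg.
Proof.
move=> ev vn; split=> [[[es cF]|cF] u|cF].
- rewrite inE => /predU1P[->|uF] w uw; last exact: cF.
  by exists e; rewrite // ev prefix_refl.
- rewrite inE => /predU1P[->|uF] w uw; last first.
    by apply: cF => //; rewrite mem_cat uF orbT.
  have /prefixP[[|c s] ws] := uw.
    by have := size_tuple w; rewrite ws cats0 => e0; rewrite e0 ltnn in vn.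
  have [||e' es /andP[h1 h2]] := cF (rcons v c) _ w.
  - by rewrite mem_cat map_f // mem_enum.
  - by rewrite ws -cat_rcons prefix_prefix.
  - by exists e' => //; rewrite h2 (prefix_trans (prefix_rcons v c)).
have [es|es] := boolP (e \in sg).
  by left; split=> // u uF; apply: cF; rewrite inE uF orbT.
right=> u; rewrite mem_cat => /orP[/mapP[c _ ->]|uF] w uw; last first.
  by apply: cF => //; rewrite inE uF orbT.
have [|e' es' /andP[h1 h2]] := cF v (mem_head _ _) w.
  exact: prefix_trans (prefix_rcons v c) uw.
exists e' => //; rewrite h2 andbT.
have /orP[//|h3] := prefix_total uw h2.
have /prefixP[[|d s] e'v] := h1.
  case/negP: es; suff <- : e' = e by [].
  by apply: word_inj; rewrite ev e'v cats0.
move: h3; rewrite e'v -cats1 !prefix_catr // eqxx /=.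
by case/andP=> /eqP-> _; rewrite eqxx ?prefix0s.
Qed.

Lemma forest_cut_children v F sg :
  forest_cut (children v ++ F) sg -> forest_cut F sg.
Proof. by move=> cF u uF; apply: cF; rewrite mem_cat uF orbT. Qed.

Lemma antichain_behead v F : antichain (v :: F) -> antichain F.
Proof. by rewrite /antichain pairwise_cons /= => /andP[/andP[_ ->] /andP[_ ->]]. Qed.

Lemma incomparable_rcons u v c : incomparable v u -> incomparable (rcons v c) u.
Proof.
move=> /andP[vu uv]; apply/andP; split.
  by apply: contraNN vu; apply: prefix_trans (prefix_rcons v c).
apply/negP => h; have := prefix_total h (prefix_rcons v c).
by rewrite (negPf vu) (negPf uv).
Qed.

Lemma pairwise_children v : pairwise incomparable (children v).
Proof.
rewrite pairwise_map; have := enum_uniq 'I_k; rewrite uniq_pairwise.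
apply: sub_pairwise => c d /= cd.
have h (x y : 'I_k) : x != y -> ~~ prefix (rcons v x) (rcons v y).
  apply: contraNN; rewrite prefixE take_oversize ?size_rcons // => /eqP h.
  by have [->] := rcons_inj (esym h).
by rewrite /incomparable !h // eq_sym.
Qed.

Lemma antichain_children v F : (size v < n)%N -> antichain (v :: F) ->
  antichain (children v ++ F).
Proof.
move=> vn; rewrite /antichain pairwise_cons pairwise_cat all_cat /=.
move=> /and3P[/andP[_ ->] /allP vF ->]; rewrite !andbT.
apply/and3P; split.
- by apply/allP => _ /mapP[c _ ->]; rewrite size_rcons.
- apply/allrelP => _ u /mapP[c _ ->] uF; exact: incomparable_rcons (vF u uF).
- exact: pairwise_children.
Qed.

(** Sum over the generators of the ideal of one tree of height h, its own edge
    included, of (-X)^(homological degree) t^(degree). *)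
Fixpoint tree_poly h : {poly R} :=
  if h is h'.+1 then t%:P + (1 - t *: 'X) * tree_poly h' ^+ k else t%:P.

Definition height v := (n - size v)%N.

(** Induction on the forest; replacing a tree of height h by its k children
    decreases the weight (k+1)^h because k (k+1)^(h-1) < (k+1)^h.  The first two
    clauses say where the multidegrees live and are what the cone needs: they
    avoid the edge e, and a generator for the expanded forest meets v while one
    for the remaining forest does not. *)
Theorem forest_frame F : antichain F -> exists A : frame K (forest_cut F),
  [/\ forall i a e, e \in @fr_supp _ _ _ A i a -> exists2 v, v \in F & prefix v (word e),
      forall i a v, v \in F -> exists2 e, e \in @fr_supp _ _ _ A i a & prefix v (word e) &
      forall i, (-1) ^+ i * fr_gen t A i = (\prod_(v <- F) tree_poly (height v))`_i].
Proof.
have [m] := ubnP (\sum_(v <- F) k.+1 ^ height v)%N.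
elim: m F => // m IH [|v F] weight aF.
  have [A [A1 A2]] := frame_unit K E t.
  have [|B [B1 B2]] := @frame_iff K E R t _ (forest_cut [::]) A; first by split.
  exists B; split=> // [i a e|i].
    by rewrite (B1 (fun s => s = set0)) // inE.
  by rewrite B2 A2 big_nil coef1; case: i => [|i]; rewrite ?mulr0 ?mulr1.
have aF' := antichain_behead aF.
have vn : (0 < size v <= n)%N by case/andP: aF => /= /andP[].
have [e ev] := word_exists vn; have {vn} /andP[v0 vn] := vn.
have wt0 u : (0 < k.+1 ^ height u)%N by rewrite expn_gt0.
have inc u : u \in F -> incomparable v u.
  by move: aF; rewrite /antichain pairwise_cons => /and3P[_ /allP h _] /h.
have [|//|A [A1 A2 A3]] := IH F.
  move: weight; rewrite big_cons ltnS; apply: leq_trans.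
  by rewrite -[X in (X < _)%N]add0n ltn_add2r.
have eA i a : e \notin @fr_supp _ _ _ A i a.
  apply/negP => /A1[u /inc/andP[_ /negP]]; by rewrite ev.
(* The case analysis on generators takes predicates of one multidegree. *)
pose P1 (s : {set E}) :=
  forall x, x \in s -> exists2 u, u \in v :: F & prefix u (word x).
pose P2 (s : {set E}) :=
  forall u, u \in v :: F -> exists2 x, x \in s & prefix u (word x).
rewrite leq_eqVlt in vn; case/orP: vn => [/eqP vn|vn].
  have [B B0] := frame_empty K E.
  have noB i : 'I_(fr_rank B i) -> False by rewrite B0 => -[].
  have [|||||C [C1 C2]] := @frame_cone K E R t _ _ A B e.
  - by [].
  - exact: forest_cut_up.
  - exact: eA.
  - by move=> i b; case: (noB i b).
  - by move=> i a b; case: (noB i b).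
  have [D [D1 D2]] := frame_iff t C (fun sg => forest_cut_leaf F sg ev vn).
  exists D; split.
  - apply: (D1 P1); apply: (C1 P1) => [i a x|i b|i b]; try by case: (noB i b).
    rewrite !inE => /predU1P[->|/A1[u uF ux]].
      by exists v; rewrite ?mem_head // ev prefix_refl.
    by exists u; rewrite // inE uF orbT.
  - apply: (D1 P2); apply: (C1 P2) => [i a u|i b|i b]; try by case: (noB i b).
    rewrite inE => /predU1P[->|/(A2 i a)[x xs ux]].
      by exists e; rewrite ?setU11 // ev prefix_refl.
    by exists x; rewrite // !inE xs orbT.
  move=> i; rewrite D2 C2 big_cons /height vn subnn /= mul_polyC coefZ -A3.
  have B0' j : fr_gen t B j = 0 by rewrite /fr_gen; apply: big1 => b; case: (noB j b).
  by rewrite B0' mulrCA; case: i => [|i]; rewrite ?B0' ?mulr0 !addr0.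
have [||B [B1 B2 B3]] := IH (children v ++ F).
- move: weight; rewrite big_cons big_cat ltnS; apply: leq_trans.
  rewrite ltn_add2r big_map big_enum /=.
  under eq_bigr do rewrite /height size_rcons.
  by rewrite sum_nat_const card_ord /height
    -[in X in (_ < X)%N](subnSK vn) expnS ltn_mul2r expn_gt0 ltnSn.
- exact: antichain_children.
have eB i b : e \notin @fr_supp _ _ _ B i b.
  apply/negP => /B1[u]; rewrite mem_cat => /orP[/mapP[c _ ->]|/inc/andP[_ /negP]].
    by rewrite ev => /size_prefix; rewrite size_rcons ltnn.
  by rewrite ev.
have dis i a b : @fr_supp _ _ _ A i a <> @fr_supp _ _ _ B i b.
  move=> eAB; pose c := Ordinal k_gt0.
  have vcF : rcons v c \in children v ++ F by rewrite mem_cat map_f // mem_enum.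
  have [x + vx] := B2 i b _ vcF; rewrite -eAB => /A1[u /inc iu ux].
  have := incomparable_rcons c iu; rewrite /incomparable -negb_or.
  by rewrite (prefix_total vx ux).
have [|||||C [C1 C2]] := @frame_cone K E R t _ _ A B e.
- by move=> sg; apply: forest_cut_children.
- exact: forest_cut_up.
- exact: eA.
- exact: eB.
- exact: dis.
have [D [D1 D2]] := frame_iff t C (fun sg => forest_cut_node F sg ev vn).
have B1' i b x : x \in @fr_supp _ _ _ B i b ->
    exists2 u, u \in v :: F & prefix u (word x).
  move=> /B1[u]; rewrite mem_cat => /orP[/mapP[c _ ->] h|uF ux].
    by exists v; rewrite ?mem_head // (prefix_trans (prefix_rcons v c)).
  by exists u; rewrite // inE uF orbT.
have B2' i b u : u \in v :: F ->
    exists2 x, x \in @fr_supp _ _ _ B i b & prefix u (word x).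
  rewrite inE => /predU1P[->|uF].
    have [|x xs vx] := B2 i b (rcons v (Ordinal k_gt0)).
      by rewrite mem_cat map_f // mem_enum.
    by exists x; rewrite // (prefix_trans (prefix_rcons _ _) vx).
  by apply: B2; rewrite mem_cat uF orbT.
exists D; split.
- apply: (D1 P1); apply: (C1 P1) => [i a x|//|i b x].
    rewrite !inE => /predU1P[->|/A1[u uF ux]].
      by exists v; rewrite ?mem_head // ev prefix_refl.
    by exists u; rewrite // inE uF orbT.
  rewrite !inE => /predU1P[->|/B1'//].
  by exists v; rewrite ?mem_head // ev prefix_refl.
- apply: (D1 P2); apply: (C1 P2) => [i a u|//|i b u uF].
    rewrite inE => /predU1P[->|/(A2 i a)[x xs ux]].
      by exists e; rewrite ?setU11 // ev prefix_refl.
    by exists x; rewrite // !inE xs orbT.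
  by have [x xs ux] := B2' i b u uF; exists x; rewrite // !inE xs orbT.
move=> i; rewrite D2 C2 big_cons /height -(subnSK vn) /=.
have eprod : \prod_(u <- children v ++ F) tree_poly (height u) =
    tree_poly (n - (size v).+1) ^+ k * \prod_(u <- F) tree_poly (height u).
  rewrite big_cat big_map big_enum /=; congr (_ * _).
  under eq_bigr do rewrite /height size_rcons.
  by rewrite prodr_const card_ord.
rewrite mulrDl -mulrA -eprod mulrBl mul1r -scalerAl !coefD coefN !coefZ coefXM.
rewrite mul_polyC coefZ -A3 -B3 !mulrDr addrA; congr (_ + _ + _).
  by rewrite mulrCA.
case: i => [|i] /=; first by rewrite !mulr0 oppr0.
by rewrite -B3 exprS mulN1r mulNr mulrCA.
Qed.

End Forests.

(** * From multigraded complexes to graded free resolutions *)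
Lemma mcoeffMXE (K : fieldType) N (p : {mpoly K[N]}) d m :
  (p * 'X_[d])@_m = if (d <= m)%MM then p@_(m - d) else 0.
Proof.
case: ifPn => [dm|ndm]; first by rewrite -{1}(submK dm) addmC mcoeffMX.
apply/eqP; rewrite mcoeff_eq0 (perm_mem (msuppMX p d)).
by apply: contra ndm => /mapP[k _ ->]; apply: lem_addr.
Qed.

Section Homogenization.
Variables (K : fieldType) (E : finType).
Local Notation N := #|E|.
Local Notation S := {mpoly K[N]}.

Definition set_mnm (sg : {set E}) : 'X_{1..N} :=
  [multinom (enum_val i \in sg : nat) | i < N].

Definition mnm_set (m : 'X_{1..N}) : {set E} := [set e | 0 < m (enum_rank e)]%N.

Lemma set_mnm_le sg m : (set_mnm sg <= m)%MM = (sg \subset mnm_set m).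
Proof.
apply/mnm_lepP/subsetP => [h e esg|h i].
  by have := h (enum_rank e); rewrite mnmE enum_rankK esg inE.
rewrite mnmE; case: (boolP (enum_val i \in sg)) => // /h.
by rewrite inE enum_valK.
Qed.

Lemma set_mnmK sg : mnm_set (set_mnm sg) = sg.
Proof. by apply/setP => e; rewrite inE mnmE enum_rankK; case: (e \in sg). Qed.

Lemma mdeg_set_mnm sg : mdeg (set_mnm sg) = #|sg|.
Proof.
transitivity (\sum_(e in E) (e \in sg : nat))%N.
  by rewrite mdegE [RHS]big_enum_val; apply: eq_bigr => i _; rewrite mnmE.
by rewrite -sum1_card [RHS]big_mkcond; apply: eq_bigr => e _; case: ifP.
Qed.

Lemma mnm_set_sub m m' : mnm_set m \subset mnm_set (m + m')%MM.
Proof. by apply/subsetP => e; rewrite !inE mnmDE addn_gt0 => ->. Qed.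

(** Back from scalars to polynomials: the monomial is the quotient of the two
    multidegrees. *)
Definition homogenize r c (s : 'I_r -> {set E}) (t : 'I_c -> {set E})
    (M : 'M[K]_(r, c)) : 'M[S]_(r, c) :=
  \matrix_(a, b) (M a b *: 'X_[set_mnm (s a) - set_mnm (t b)]).

(** The multidegree m component of a vector of polynomials, which lies in the
    strand of the support of m. *)
Definition multipart r (s : 'I_r -> {set E}) (m : 'X_{1..N}) (v : 'rV[S]_r) :
    'rV[K]_r :=
  \row_a if s a \subset mnm_set m then (v 0 a)@_(m - set_mnm (s a)) else 0.

Lemma within_multipart r (s : 'I_r -> {set E}) m v :
  within s (mnm_set m) (multipart s m v).
Proof. by move=> a; rewrite mxE; case: ifP => // _; rewrite eqxx. Qed.

Lemma multipart_inj r (s : 'I_r -> {set E}) v w :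
  (forall m, multipart s m v = multipart s m w) -> v = w.
Proof.
move=> h; apply/rowP => a; apply/mpolyP => k.
have /rowP/(_ a) := h (set_mnm (s a) + k)%MM.
by rewrite !mxE -set_mnm_le lem_addr addmC addmK.
Qed.

Lemma multipart_mul r c (s : 'I_r -> {set E}) (t : 'I_c -> {set E}) M m v :
  respects (fun x y => x \subset y) s t M ->
  multipart t m (v *m homogenize s t M) = multipart s m v *m M.
Proof.
move=> sM; apply/rowP => b; rewrite !mxE.
have [tb|tb] := boolP (t b \subset mnm_set m).
  rewrite raddf_sum; apply: eq_bigr => a _; rewrite !mxE.
  have [->|nz] := eqVneq (M a b) 0.
    by rewrite scale0r !mulr0 raddf0.
  have sab := sM _ _ nz.
  rewrite -scalerAr /= mcoeffZ mcoeffMXE mulrC; congr (_ * _).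
  have le1 : (set_mnm (t b) <= set_mnm (s a))%MM by rewrite set_mnm_le set_mnmK.
  have le2 : (set_mnm (t b) <= m)%MM by rewrite set_mnm_le.
  rewrite -set_mnm_le.
  have -> : (set_mnm (s a) - set_mnm (t b) <= m - set_mnm (t b))%MM =
      (set_mnm (s a) <= m)%MM.
    apply/mnm_lepP/mnm_lepP => h i; have := h i; rewrite !mnmBE leq_sub2rE //;
      exact: (mnm_lepP le2).
  case: ifP => // le3; congr (_ @_ _); apply/mnmP => i.
  have /mnm_lepP/(_ i) le1i := le1.
  by rewrite !mnmBE subnBA // subnK // (leq_trans le1i) //; have /mnm_lepP := le3.
rewrite big1 // => a _; rewrite mxE.
have [->|nz] := eqVneq (M a b) 0; first by rewrite mulr0.
case: ifP => [sa|_]; last by rewrite mul0r.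
by rewrite (subset_trans (sM _ _ nz) sa) in tb.
Qed.

Lemma multipart_eq0 r (s : 'I_r -> {set E}) v : exists L : seq 'X_{1..N},
  uniq L /\ forall m, m \notin L -> multipart s m v = 0.
Proof.
exists (undup (flatten [seq [seq (set_mnm (s a) + k)%MM | k <- msupp (v 0 a)]
                       | a <- enum 'I_r])); split; first exact: undup_uniq.
move=> m; rewrite mem_undup => mL; apply/rowP => a; rewrite !mxE.
case: ifP => // sa; apply/eqP; rewrite mcoeff_eq0; apply: contra mL => h.
apply/flattenP; eexists; first by apply/mapP; exists a; rewrite ?mem_enum.
by apply/mapP; eexists; first exact: h; rewrite addmC submK // set_mnm_le.
Qed.

(** Solutions found in every multidegree are glued over the finitely many
    multidegrees in which v has a nonzero component. *)
Lemma multipart_assemble r c (s : 'I_r -> {set E}) (t : 'I_c -> {set E}) M v :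
  respects (fun x y => x \subset y) s t M ->
  (forall m, exists w, within s (mnm_set m) w /\ multipart t m v = w *m M) ->
  exists w, v = w *m homogenize s t M.
Proof.
move=> sM /boolp.choice[w /all_and2[w1 w2]].
have [L [uL L0]] := multipart_eq0 t v.
pose W : 'rV[S]_r := \row_a \sum_(m <- L) w m 0 a *: 'X_[m - set_mnm (s a)].
exists W; apply: (multipart_inj (s := t)) => m; rewrite multipart_mul //.
have [mL|mL] := boolP (m \in L); last first.
  rewrite L0 // [multipart _ _ _](_ : _ = 0) ?mul0mx //; apply/rowP => a.
  rewrite !mxE; case: ifP => // sa; rewrite raddf_sum big1_seq // => m' /andP[_ m'L].
  rewrite /= mcoeffZ mcoeffX; have [->|nz] := eqVneq (w m' 0 a) 0; first by rewrite mul0r.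
  have sa' := w1 _ _ nz; case: eqP => [e|]; last by rewrite mulr0.
  move: mL; rewrite -(submK (m := set_mnm (s a)) (m' := m)) ?set_mnm_le //.
  by rewrite -e submK ?set_mnm_le // m'L.
rewrite w2; congr (_ *m _); apply/rowP => a; rewrite !mxE.
case: ifPn => [sa|nsa]; last by apply/eqP; apply: contraNT nsa => /w1.
rewrite raddf_sum (big_rem m) //= mcoeffZ mcoeffX eqxx mulr1 big1_seq ?addr0 //.
move=> m' /andP[_]; rewrite mem_rem_uniq // inE => /andP[mm' m'L].
rewrite mcoeffZ mcoeffX; have [->|nz] := eqVneq (w m' 0 a) 0; first by rewrite mul0r.
have sa' := w1 _ _ nz; case: eqP => [e|]; last by rewrite mulr0.
case/eqP: mm'; rewrite -(submK (m := set_mnm (s a)) (m' := m)) ?set_mnm_le //.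
by rewrite -e submK ?set_mnm_le.
Qed.

End Homogenization.

Section FrameResolution.
Variables (K : fieldType) (E : finType) (I : {set E} -> Prop).
Local Notation N := #|E|.
Local Notation S := {mpoly K[N]}.
Variables (J : S -> Prop) (A : frame K I).
Hypothesis JP : forall f, J f <-> forall m, f@_m != 0 -> I (mnm_set m).
Hypothesis I_up : forall sg tau : {set E}, sg \subset tau -> I sg -> I tau.
Hypothesis supp_neq0 : forall i a, @fr_supp _ _ _ A i a != set0.

(** Resolving S/J instead of J puts one generator, of empty multidegree, below
    those of J. *)
Definition aug_rank i := if i is i'.+1 then fr_rank A i' else 1%N.

Definition aug_supp i : 'I_(aug_rank i) -> {set E} :=
  match i return 'I_(aug_rank i) -> {set E} with
  | 0 => fun=> set0
  | i'.+1 => @fr_supp _ _ _ A i'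
  end.

Definition aug_diff i : 'M[K]_(aug_rank i.+1, aug_rank i) :=
  match i return 'M[K]_(aug_rank i.+1, aug_rank i) with
  | 0 => fr_aug A
  | i'.+1 => fr_diff A i'
  end.

Definition res_diff i := homogenize (@aug_supp i.+1) (@aug_supp i) (aug_diff i).

Lemma aug_diff_proper i :
  respects (fun x y => x \proper y) (@aug_supp i.+1) (@aug_supp i) (aug_diff i).
Proof.
case: i => [|i] a b; last exact: fr_diff_supp.
by move=> _; rewrite proper0; apply: supp_neq0.
Qed.

Lemma aug_diff_sub i :
  respects (fun x y => x \subset y) (@aug_supp i.+1) (@aug_supp i) (aug_diff i).
Proof. by move=> a b /aug_diff_proper/proper_sub. Qed.

Lemma aug_diff_cycle i (v : 'rV_(aug_rank i.+1)) :
  v *m aug_diff i = 0 <-> frame_cycle (fr_diff A) (fr_aug A) v.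
Proof. by case: i v. Qed.

Let deg i (a : 'I_(aug_rank i)) := #|aug_supp a|.

Lemma mul_aug (v : 'rV[S]_1) : (v *m (1%:M : 'cV[S]_1)) 0 0 = v 0 0.
Proof. by rewrite mulmx1. Qed.

Lemma res_diff_homog i (a : 'I_(aug_rank i.+1)) (b : 'I_(aug_rank i)) :
  (deg b <= deg a)%N -> res_diff i a b \is (deg a - deg b).-homog.
Proof.
move=> _; rewrite mxE; have [->|nz] := eqVneq (aug_diff i a b) 0.
  by rewrite scale0r dhomog0.
have sba := aug_diff_sub nz.
apply: dhomogZ; rewrite -[_ \in _]/(_ \is _) dhomogX /deg -!mdeg_set_mnm.
have le1 : (set_mnm (aug_supp b) <= set_mnm (aug_supp a))%MM.
  by rewrite set_mnm_le set_mnmK.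
by rewrite -{2}(submK le1) mdegD addnK.
Qed.

Lemma res_diff_eq0 i (a : 'I_(aug_rank i.+1)) (b : 'I_(aug_rank i)) :
  (deg a < deg b)%N -> res_diff i a b = 0.
Proof.
move=> lt; rewrite mxE; have [->|nz] := eqVneq (aug_diff i a b) 0.
  by rewrite scale0r.
by move: lt; rewrite ltnNge (subset_leq_card (aug_diff_sub nz)).
Qed.

Lemma res_aug_homog (a : 'I_(aug_rank 0)) :
  (1%:M : 'cV[S]_1) a 0 \is (deg a).-homog.
Proof. by rewrite ord1 mxE eqxx /deg /= cards0 dhomog1. Qed.

Lemma res_aug_surj (f : S) : exists v : 'rV[S]_(aug_rank 0),
  J (f - (v *m (1%:M : 'cV[S]_1)) 0 0).
Proof.
exists f%:M; rewrite mul_aug mxE eqxx mulr1n subrr.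
by apply/JP => m; rewrite mcoeff0 eqxx.
Qed.

Lemma res_aug_exact (v : 'rV[S]_(aug_rank 0)) :
  J ((v *m (1%:M : 'cV[S]_1)) 0 0) <->
  exists w : 'rV[S]_(aug_rank 1), v = w *m res_diff 0.
Proof.
have part0 m : multipart (@aug_supp 0) m v = ((v 0 0)@_m)%:M.
  apply/rowP => a; rewrite !ord1 !mxE sub0set eqxx mulr1n; congr (_ @_ _).
  by apply/mnmP => i; rewrite mnmBE mnmE inE subn0.
rewrite mul_aug; split=> [/JP Jv|[w vw]].
  apply: (multipart_assemble (@aug_diff_sub 0)) => m; rewrite part0.
  have [->|/Jv/(fr_surj A)[w w1 w2]] := eqVneq ((v 0 0)@_m) 0.
    by exists 0; split; [apply: within0|rewrite mul0mx raddf0].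
  exists ((v 0 0)@_m *: w); split; first exact: withinZ.
  by rewrite -scalemxAl [w *m _]w2 scalemx1.
apply/JP => m nz; move: (part0 m); rewrite {1}vw multipart_mul; last exact: aug_diff_sub.
set u := multipart _ _ _; have uw : within (@aug_supp 1) (mnm_set m) u.
  exact: within_multipart.
have [u0|[a ua _]] : u = 0 \/ exists2 a, u 0 a != 0 & true.
  have [->|] := eqVneq u 0; first by left.
  by move=> /rV0Pn[a ua]; right; exists a.
  rewrite u0 mul0mx => /rowP/(_ 0); rewrite !mxE eqxx mulr1n => e.
  by rewrite -e eqxx in nz.
by move=> _; apply: I_up (uw _ ua) (fr_aug_supp _).
Qed.

Lemma res_diff_exact i (v : 'rV[S]_(aug_rank i.+1)) :
  v *m res_diff i = 0 <->
  exists w : 'rV[S]_(aug_rank i.+2), v = w *m res_diff i.+1.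
Proof.
split=> [v0|[w ->]].
  apply: (multipart_assemble (@aug_diff_sub i.+1)) => m.
  have [||w w1 w2] := @fr_exact _ _ _ A (mnm_set m) i (multipart (@aug_supp i.+1) m v).
  - exact: within_multipart.
  - apply/aug_diff_cycle; rewrite -(multipart_mul _ _ (@aug_diff_sub i)).
    rewrite [v *m _]v0.
    by apply/rowP => a; rewrite !mxE mcoeff0 if_same.
  - by exists w.
apply: (multipart_inj (s := @aug_supp i)) => m.
rewrite multipart_mul; last exact: aug_diff_sub.
rewrite multipart_mul; last exact: aug_diff_sub.
have /aug_diff_cycle -> := @fr_complex _ _ _ A i (multipart (@aug_supp i.+2) m w).
by apply/rowP => a; rewrite !mxE mcoeff0 if_same.
Qed.

Definition frame_resolution : graded_free_resolution J :=
  @GradedFreeResolution K N J aug_rank deg res_diff (1%:M : 'cV[S]_1)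
    res_diff_homog res_diff_eq0 res_aug_homog res_aug_surj res_aug_exact
    res_diff_exact.

Lemma frame_resolution_minimal i : fibre_diff frame_resolution i = 0.
Proof.
apply/matrixP => a b; rewrite !mxE mcoeffZ mcoeffX.
have [->|nz] := eqVneq (aug_diff i a b) 0; first by rewrite mul0r.
have /properP[_ [e ea eb]] := aug_diff_proper nz.
case: eqP => [/mnmP/(_ (enum_rank e))|]; last by rewrite mulr0.
by rewrite mnmBE !mnmE enum_rankK ea (negPf eb).
Qed.

(** The frame resolution is minimal, so it computes the Betti numbers of every
    resolution. *)
Theorem betti_frame (F : graded_free_resolution J) i j :
  betti F i.+1 j = #|[set a | #|@fr_supp _ _ _ A i a| == j]|.
Proof.
have ID m m' : I (mnm_set m) -> I (mnm_set (m + m')%MM).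
  exact/I_up/mnm_set_sub.
by rewrite (betti_minimal ID JP F i j frame_resolution_minimal).
Qed.

End FrameResolution.

Section CutBetti.
Variables (K : fieldType) (k n : nat).
Local Notation E := (edge k n).
Local Notation S := {mpoly K[#|{: E}|]}.

(** The ideal of a path is generated by variables: membership is decided
    monomial by monomial. *)
Lemma path_primeP (w : n.-tuple 'I_k) (f : S) :
  path_prime w f <->
  forall m, f@_m != 0 -> exists2 e, e \in mnm_set m & on_path w e.
Proof.
split=> [[c ->] m|h].
  rewrite raddf_sum => nz.
  have [e] : exists e, on_path w e && ((c e * edge_var K e)@_m != 0).
    apply/existsP; apply: contraNT nz => /existsPn h.
    by rewrite big1 // => e we; apply/eqP; have := h e; rewrite we negbK.
  case/andP=> we nze; exists e => //; rewrite inE; move: nze.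
  rewrite mcoeffMXE; case: ifP => [/mnm_lepP/(_ (enum_rank e))|]; last by rewrite eqxx.
  by rewrite mnm1E eqxx.
have PD g1 g2 : path_prime w g1 -> path_prime w g2 -> path_prime w (g1 + g2).
  move=> [c1 ->] [c2 ->]; exists (fun e => c1 e + c2 e).
  by rewrite -big_split; apply: eq_bigr => e _; rewrite mulrDl.
rewrite [f]mpolyE big_seq; elim/big_ind: _ => [|g1 g2|m].
- by exists (fun=> 0); rewrite big1 // => e _; rewrite mul0r.
- exact: PD.
rewrite mcoeff_msupp => /h[e em we].
exists (fun e' => if e' == e then f@_m *: 'X_[m - U_(enum_rank e)] else 0).
rewrite (bigD1 e) //= eqxx big1 ?addr0 => [|e' /andP[_ /negPf->]]; last by rewrite mul0r.
rewrite /edge_var -scalerAl -mpolyXD submK //.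
apply/mnm_lepP => i; rewrite mnm1E; case: eqP => // <-.
by move: em; rewrite inE.
Qed.

Lemma cut_idealP (f : S) : (0 < n)%N -> cut_ideal f <->
  forall m, f@_m != 0 -> forest_cut (children ([::] : seq 'I_k)) (mnm_set m).
Proof.
move=> n0; split=> [Jf m nz v vF w vw|h w].
  have /path_primeP/(_ m nz)[e em we] := Jf w.
  exists e => //; rewrite [prefix (word e) w]we andbT.
  have := valP e; move: vw we; rewrite /on_path /word => + + e0.
  case/mapP: vF => c _ -> /prefixP[s ->].
  by case: (bseqval (val e)) e0 => //= d s' _ /andP[/eqP-> _]; rewrite eqxx prefix0s.
apply/path_primeP => m nz.
case: w => -[|c s] /= sz; first by rewrite -(eqP sz) in n0.
have [||e em /andP[_ ew]] := h m nz [:: c] _ (@Tuple n _ (c :: s) sz).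
- by apply/mapP; exists c; rewrite ?mem_enum.
- by rewrite /= eqxx prefix0s.
- by exists e.
Qed.

End CutBetti.

(** The trees hanging from the k edges at the root have height n, whence the
    power k. *)
Theorem cut_ideal_betti (K : fieldType) (k n : nat) (R : comNzRingType) (t : R)
    (F : graded_free_resolution (@cut_ideal K k n.+1)) i :
  (0 < k)%N -> exists (r : nat) (d : 'I_r -> nat),
  [/\ forall a, (0 < d a)%N,
      forall j, betti F i.+1 j = #|[set a | d a == j]| &
      (-1) ^+ i * \sum_a t ^+ d a = (tree_poly k t n ^+ k)`_i].
Proof.
move=> k0; pose f0 := children ([::] : seq 'I_k).
have aF : antichain n.+1 f0.
  by rewrite /antichain pairwise_children andbT; apply/allP => _ /mapP[c _ ->].
have [A [A1 A2 A3]] := forest_frame K t k0 aF.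
have A0 l a : @fr_supp _ _ _ A l a != set0.
  have [|e eA _] := A2 l a [:: Ordinal k0].
    by apply/mapP; exists (Ordinal k0); rewrite ?mem_enum.
  by apply/set0Pn; exists e.
exists (fr_rank A i), (fun a => #|@fr_supp _ _ _ A i a|); split.
- by move=> a; rewrite card_gt0.
- move=> j; apply: betti_frame => //; first by move=> f; apply: cut_idealP.
  exact: forest_cut_up.
- rewrite -/(fr_gen t A i) A3 big_map big_enum /=.
  under eq_bigr do rewrite /height /= subSS subn0.
  by rewrite prodr_const card_ord.
Qed.

End CutResolution.

From mathcomp Require Import ring lra.
From mathcomp Require Import all_classical all_reals all_analysis.
Import numFieldNormedType.Exports.
Import CutResolution.
Local Open Scope classical_set_scope.
Local Open Scope ring_scope.

(** * The critical parameter *)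
Section Tangent.
Variable R : realFieldType.
Implicit Types b y : R.

Lemma tangent_step k b y :
  y * (b ^+ k.+1 + k.+1%:R * b ^+ k * (y - b)) =
  b ^+ k.+2 + k.+2%:R * b ^+ k.+1 * (y - b) + k.+1%:R * b ^+ k * (y - b) ^+ 2.
Proof. by rewrite !exprS -(natr1 k.+1); ring. Qed.

Lemma tangent_le k b y : 0 <= b -> 0 <= y ->
  b ^+ k.+1 + k.+1%:R * b ^+ k * (y - b) <= y ^+ k.+1.
Proof.
move=> b0 y0; elim: k => [|k IH]; first by rewrite !expr1 expr0; lra.
rewrite [leRHS]exprS; apply: le_trans (ler_wpM2l y0 IH).
by rewrite tangent_step lerDl mulr_ge0 ?sqr_ge0 // mulr_ge0 ?exprn_ge0.
Qed.

Lemma tangent_lt k b y : 0 < b -> 0 <= y -> y != b ->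
  b ^+ k.+2 + k.+2%:R * b ^+ k.+1 * (y - b) < y ^+ k.+2.
Proof.
move=> b0 y0 yb; rewrite [ltRHS]exprS.
apply: lt_le_trans (ler_wpM2l y0 (tangent_le k (ltW b0) y0)).
rewrite tangent_step ltrDl mulr_gt0 //; first by rewrite mulr_gt0 ?exprn_gt0.
by rewrite lt_def sqrf_eq0 subr_eq0 yb sqr_ge0.
Qed.

End Tangent.

(** * Polynomials with nonnegative coefficients *)
Section PositivePolynomials.
Variable R : realFieldType.
Implicit Types p r s : {poly R}.

Definition pos_poly p := forall i, 0 <= p`_i.

Lemma pos_polyC c : 0 <= c -> pos_poly c%:P.
Proof. by move=> c0 i; rewrite coefC; case: ifP. Qed.

Lemma pos_polyX : pos_poly 'X.
Proof. by move=> i; rewrite coefX ler0n. Qed.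

Lemma pos_polyD p r : pos_poly p -> pos_poly r -> pos_poly (p + r).
Proof. by move=> hp hr i; rewrite coefD addr_ge0. Qed.

Lemma pos_polyM p r : pos_poly p -> pos_poly r -> pos_poly (p * r).
Proof. by move=> hp hr i; rewrite coefM sumr_ge0 // => j _; rewrite mulr_ge0. Qed.

Lemma pos_polyXn p n : pos_poly p -> pos_poly (p ^+ n).
Proof.
move=> hp; elim: n => [|n IH]; first by rewrite expr0 -polyC1; apply: pos_polyC.
by rewrite exprS; apply: pos_polyM.
Qed.

Lemma pos_poly_sum (I : Type) (l : seq I) (P : pred I) (F : I -> {poly R}) :
  (forall i, P i -> pos_poly (F i)) -> pos_poly (\sum_(i <- l | P i) F i).
Proof.
move=> hF; elim/big_ind: _ => //; last exact: pos_polyD.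
by move=> i; rewrite coef0.
Qed.

Lemma pos_poly_lexp p r n : pos_poly p -> pos_poly (r - p) ->
  pos_poly (r ^+ n - p ^+ n).
Proof.
move=> hp hrp; have hr : pos_poly r by rewrite -(subrK p r); apply: pos_polyD.
rewrite subrXX; apply: pos_polyM => //; apply: pos_poly_sum => i _.
by apply: pos_polyM; apply: pos_polyXn.
Qed.

Lemma coefMr_ge p r i : pos_poly p -> pos_poly r -> p`_i * r`_0 <= (p * r)`_i.
Proof.
move=> hp hr; rewrite coefM (bigD1 ord_max) //= subnn lerDl sumr_ge0 // => j _.
by rewrite mulr_ge0.
Qed.

Lemma coefXn_gt0 p n i : pos_poly p -> 0 < p`_0 -> 0 < p`_i -> 0 < (p ^+ n.+1)`_i.
Proof.
move=> hp p0 pi; elim: n => [|n IH] //; rewrite exprSr.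
apply: lt_le_trans (coefMr_ge i (pos_polyXn _ hp) hp).
by rewrite mulr_gt0.
Qed.

End PositivePolynomials.

Section Growth.
Variable R : realFieldType.
Implicit Types (p : {poly R}) (rho q : R).

(** f' >= rho f coefficientwise, up to degree N.  This form of a lower bound on
    the ratios of consecutive coefficients is the one that powers preserve. *)
Definition grows rho N p := forall i, (i < N)%N -> rho * p`_i <= p^`()`_i.

Lemma grows_le rho rho' N p : pos_poly p -> rho' <= rho -> grows rho N p ->
  grows rho' N p.
Proof. by move=> hp le g i iN; apply: le_trans (g i iN); rewrite ler_wpM2r. Qed.

Lemma growsXn rho N p k : pos_poly p -> grows rho N p ->
  grows (k%:R * rho) N (p ^+ k).
Proof.
move=> hp g i iN; rewrite deriv_exp.
case: k => [|k]; first by rewrite !mul0r mulr0n coef0.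
rewrite coefMn -[leRHS]mulr_natl -mulrA ler_wpM2l //= exprS !coefM mulr_sumr.
apply: ler_sum => j _; rewrite mulrA ler_wpM2r ?(pos_polyXn _ hp) //.
by apply: g; apply: leq_ltn_trans iN; rewrite -ltnS.
Qed.

(** Only the constant coefficient loses: it becomes q + f_0, while the added
    q X f contributes q f_0 to the coefficient of X. *)
Lemma grows_affine rho rho' q N p : pos_poly p -> 0 <= q -> 0 <= rho' ->
  rho' <= rho -> rho' * (q + p`_0) <= (rho + q) * p`_0 -> grows rho N p ->
  grows rho' N (q%:P + (1 + q *: 'X) * p).
Proof.
move=> hp q0 r0 rr r1 g i iN.
have cE j : (q%:P + (1 + q *: 'X) * p)`_j.+1 = p`_j.+1 + q * p`_j.
  by rewrite coefD coefC add0r mulrDl mul1r -scalerAl coefD coefZ coefXM.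
have c0 : (q%:P + (1 + q *: 'X) * p)`_0 = q + p`_0.
  by rewrite coefD coefC mulrDl mul1r -scalerAl coefD coefZ coefXM mulr0 addr0.
rewrite coef_deriv cE; case: i iN => [|i] iN.
  rewrite c0; apply: le_trans r1 _; rewrite mulrDl mulr1n lerD2r.
  by have := g 0%N iN; rewrite coef_deriv.
have gi := g i (ltnW iN); have := g _ iN; rewrite cE !coef_deriv in gi * => gi1.
have h1 : rho' * p`_i.+1 <= p`_i.+2 *+ i.+2.
  by apply: le_trans gi1; rewrite ler_wpM2r.
have h2 : rho' * p`_i <= p`_i.+1 *+ i.+2.
  apply: le_trans (_ : p`_i.+1 *+ i.+1 <= _).
    by apply: le_trans gi; rewrite ler_wpM2r.
  by rewrite [leRHS]mulrS lerDr.
rewrite mulrnDl mulrDr lerD // mulrCA -mulrnAr ler_wpM2l //.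
Qed.

(** The partial sums T_m, with their sign removed, satisfy
    T_(m+1) = D_(m+1) - T_m, so the two bounds propagate together. *)
Lemma alternating_sum_bounds (D : nat -> R) m :
  0 <= D 0%N -> (forall i, (i < m)%N -> 2 * D i <= D i.+1) ->
  D m / 2 <= (-1) ^+ m * \sum_(i < m.+1) (-1) ^+ i * D i <= D m.
Proof.
move=> D0; elim: m => [|m IH] hD.
  by rewrite big_ord1 expr0 !mul1r; lra.
have {IH}/andP[h1 h2] := IH (fun i im => hD i (ltnW im)).
rewrite big_ord_recr /= mulrDr [X in _ + X]mulrA -exprMn mulrNN mulr1 expr1n mul1r.
rewrite exprS -mulrA mulN1r.
have := hD m (ltnSn m); set T := _ * \sum_(i < _) _ in h1 h2 *; lra.
Qed.

End Growth.

Section Limits.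
Variables (R : realType) (T : Type) (F : set_system T).
Context {FF : Filter F}.

Lemma cvg_expn (f : T -> R) (a : R) n : f x @[x --> F] --> a ->
  f x ^+ n @[x --> F] --> a ^+ n.
Proof.
move=> fa; elim: n => [|n IH]; first by apply: cvg_cst.
by under eq_fun do rewrite exprS; rewrite exprS; apply: cvgM.
Qed.

Lemma cvg_ord_sum N (f : nat -> T -> R) (a : nat -> R) :
  (forall i, (i < N)%N -> f i x @[x --> F] --> a i) ->
  (\sum_(i < N) f i x) @[x --> F] --> \sum_(i < N) a i.
Proof.
elim: N => [|N IH] fa.
  by rewrite big_ord0; under eq_fun do rewrite big_ord0; apply: cvg_cst.
rewrite big_ord_recr; under eq_fun do rewrite big_ord_recr.
by apply: cvgD; [apply: IH => i iN; apply: fa; apply: ltnW|apply: fa].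
Qed.

End Limits.

Section Critical.
Variables (R : realType) (k : nat).
Hypothesis k_gt1 : (1 < k)%N.

(** The point where b - b^k is maximal on the nonnegative axis; the maximum is
    the critical parameter [qstarE]. *)
Definition bstar : R := k%:R `^ (- (k%:R - 1)^-1).

Let k1_neq0 : (k%:R - 1 : R) != 0.
Proof. by rewrite subr_eq0 (eqr_nat R k 1) gtn_eqF. Qed.

Lemma bstar_gt0 : 0 < bstar.
Proof. by rewrite powR_gt0 // ltr0n ltnW. Qed.

Lemma bstar_expn : k%:R * bstar ^+ k.-1 = 1.
Proof.
have k0 : 0 < (k%:R : R) by rewrite ltr0n ltnW.
rewrite -powR_mulrn ?ltW ?bstar_gt0 // -powRrM.
have -> : k.-1%:R = k%:R - 1 :> R by rewrite -subn1 natrB // ltnW.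
by rewrite mulNr mulVf // powRN powRr1 ?ltW // mulfV ?gt_eqF.
Qed.

Lemma qstarE : qstar R k = bstar - bstar ^+ k.
Proof.
have k0 : 0 < (k%:R : R) by rewrite ltr0n ltnW.
have -> : bstar ^+ k = bstar / k%:R.
  have := bstar_expn; case: k k_gt1 k0 => // k' _ k0 /= h.
  apply: (mulfI (lt0r_neq0 k0)).
  by rewrite exprS mulrCA h mulr1 mulrCA mulfV ?gt_eqF // mulr1.
rewrite /qstar.
have -> : (k%:R - 2) / (k%:R - 1) = 1 + - (k%:R - 1)^-1 :> R by field.
rewrite powRD; last by rewrite (lt0r_neq0 k0) implybT.
rewrite powRr1 ?ltW // -/bstar; field; exact: lt0r_neq0.
Qed.

Lemma qstar_gt0 : 0 < qstar R k.
Proof.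
rewrite qstarE subr_gt0; have b0 := bstar_gt0.
have := bstar_expn; case: k k_gt1 => // k' k1 /= h.
rewrite exprS -[ltRHS]mulr1 ltr_pM2l // -h.
by rewrite ltr_pMl ?exprn_gt0 // (ltr_nat R 1).
Qed.

(** The tangent to b^k at b* has slope 1 because k b*^(k-1) = 1, and b^k is
    convex. *)
Lemma gap_le_qstar b : 0 <= b -> b - b ^+ k <= qstar R k.
Proof.
move=> b0; rewrite qstarE; have := bstar_expn; have := bstar_gt0.
case: k k_gt1 => // k' _ /= bs0 h.
by have := tangent_le k' (ltW bs0) b0; rewrite h; lra.
Qed.

Lemma gap_eq_qstar b : 0 <= b -> b - b ^+ k = qstar R k -> b = bstar.
Proof.
move=> b0; rewrite qstarE; have := bstar_expn; have := bstar_gt0.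
case: k k_gt1 => // -[//|k'] _ /= bs0 h e; apply/eqP/negPn/negP => ne.
by have := tangent_lt k' bs0 b0 ne; rewrite h; lra.
Qed.

End Critical.

(** * The iteration satisfied by the Hilbert series *)
Section Orbits.
Variables (R : realType) (k : nat) (q : R).
Hypothesis q_ge0 : 0 <= q.
Hypothesis q_le1 : q <= 1.

Definition cut_poly n : {poly R} := if n is n'.+1 then tree_poly k q n' ^+ k else 0.

(** Up to the substitution of -X for X these are the [cut_poly], whose
    coefficients alternate in sign [cut_poly_coef]. *)
Fixpoint abs_poly n : {poly R} :=
  if n is n'.+1 then (q%:P + (1 + q *: 'X) * abs_poly n') ^+ k else 0.

Lemma cut_polyS n :
  cut_poly n.+1 = (q%:P + (1 - q *: 'X) * cut_poly n) ^+ k.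
Proof. by case: n => [|n] //=; rewrite mulr0 addr0. Qed.

Lemma cut_polyE n : cut_poly n = abs_poly n \Po (- 'X).
Proof.
elim: n => [|n IH]; first by rewrite comp_poly0.
rewrite cut_polyS IH /= rmorphXn /= comp_polyD comp_polyC comp_polyM comp_polyD.
by rewrite comp_polyZ comp_polyX -polyC1 comp_polyC scalerN.
Qed.

Lemma coef_compNX (p : {poly R}) i : (p \Po (- 'X))`_i = (-1) ^+ i * p`_i.
Proof.
have -> : p \Po (- 'X) = \sum_(j < size p) (p`_j * (-1) ^+ j) *: 'X^j.
  rewrite comp_polyE; apply: eq_bigr => j _.
  rewrite -scalerA; congr (_ *: _).
  by rewrite -scaleN1r exprZn.
rewrite coef_sumMXn; case: (ltnP i (size p)) => ip.
  by rewrite (big_pred1 (Ordinal ip)) 1?mulrC // => j; rewrite /= -val_eqE.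
rewrite nth_default // mulr0 big1 // => j /eqP ji.
by rewrite -ji leqNgt ltn_ord in ip.
Qed.

Lemma cut_poly_coef n i : (cut_poly n)`_i = (-1) ^+ i * (abs_poly n)`_i.
Proof. by rewrite cut_polyE coef_compNX. Qed.

Lemma cut_poly_horner n x : (cut_poly n).[x] = (abs_poly n).[- x].
Proof. by rewrite cut_polyE horner_comp hornerN hornerX. Qed.

Definition cut_step x s : R := (q + (1 - q * x) * s) ^+ k.

Definition cut_value x n : R := (cut_poly n).[x].

Lemma cut_value0 x : cut_value x 0 = 0.
Proof. by rewrite /cut_value horner0. Qed.

Lemma cut_valueS x n : cut_value x n.+1 = cut_step x (cut_value x n).
Proof. by rewrite /cut_value cut_polyS !hornerE. Qed.

Lemma abs_poly_ge0 n : pos_poly (abs_poly n).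
Proof.
elim: n => [|n IH] /=; first by move=> i; rewrite coef0.
apply/pos_polyXn/pos_polyD/pos_polyM => //; first exact: pos_polyC.
apply: pos_polyD; first by rewrite -polyC1; apply: pos_polyC.
by rewrite -mul_polyC; apply: pos_polyM (pos_polyX _); apply: pos_polyC.
Qed.

Lemma abs_poly_nondec n : pos_poly (abs_poly n.+1 - abs_poly n).
Proof.
have aff p : pos_poly p -> pos_poly ((1 + q *: 'X) * p).
  move=> hp; apply: pos_polyM => //.
  apply: pos_polyD; first by rewrite -polyC1; apply: pos_polyC.
  by rewrite -mul_polyC; apply: pos_polyM (pos_polyX _); apply: pos_polyC.
elim: n => [|n IH]; first by rewrite subr0; apply: abs_poly_ge0.
rewrite [abs_poly n.+2]/= [in X in _ - X]/=; apply: pos_poly_lexp.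
  by apply: pos_polyD; [apply: pos_polyC|apply/aff/abs_poly_ge0].
by rewrite opprD addrACA subrr add0r -mulrBr; apply: aff.
Qed.

Lemma abs_coef_nondec i : {homo (fun n => (abs_poly n)`_i) : m n / (m <= n)%N >-> m <= n}.
Proof.
apply: homo_leq => // [|n]; first exact: le_trans.
by rewrite -subr_ge0 -coefB; apply: abs_poly_nondec.
Qed.

Section Monotone.
Variable x : R.
Hypothesis x_le1 : x <= 1.

Lemma slope_ge0 : 0 <= 1 - q * x.
Proof. by rewrite subr_ge0; apply: le_trans q_le1; rewrite -[leRHS]mulr1 ler_wpM2l. Qed.

Lemma cut_step_ge0 s : 0 <= s -> 0 <= cut_step x s.
Proof. by move=> s0; rewrite exprn_ge0 // addr_ge0 // mulr_ge0 // slope_ge0. Qed.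

Lemma cut_step_le s s' : 0 <= s -> s <= s' -> cut_step x s <= cut_step x s'.
Proof.
move=> s0 ss'; apply: lerXn2r; rewrite ?nnegrE ?addr_ge0 ?mulr_ge0 ?slope_ge0 //.
  exact: le_trans ss'.
by rewrite lerD2l ler_wpM2l // slope_ge0.
Qed.

Lemma cut_value_ge0 n : 0 <= cut_value x n.
Proof. by elim: n => [|n IH]; rewrite ?cut_value0 // cut_valueS cut_step_ge0. Qed.

Lemma cut_value_nondec : {homo cut_value x : m n / (m <= n)%N >-> m <= n}.
Proof.
apply: homo_leq => // [|n]; first exact: le_trans.
elim: n => [|n IH]; first by rewrite cut_value0 cut_value_ge0.
by rewrite [leLHS]cut_valueS cut_valueS cut_step_le // cut_value_ge0.
Qed.

Lemma cut_value_le M n : 0 <= M -> cut_step x M <= M -> cut_value x n <= M.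
Proof.
move=> M0 hM; elim: n => [|n IH]; first by rewrite cut_value0.
by rewrite cut_valueS; apply: le_trans hM; apply: cut_step_le => //; apply: cut_value_ge0.
Qed.

Lemma cut_step_cvg (u : nat -> R) l : u n @[n --> \oo] --> l ->
  cut_step x (u n) @[n --> \oo] --> cut_step x l.
Proof.
by move=> ul; apply: cvg_expn; apply: cvgD; [apply: cvg_cst|apply: cvgMr].
Qed.

Lemma cut_value_fixpoint l : cut_value x n @[n --> \oo] --> l -> l = cut_step x l.
Proof.
move=> ul; have h1 := cut_step_cvg ul.
have h2 : cut_step x (cut_value x n) @[n --> \oo] --> l.
  by under eq_fun do rewrite -cut_valueS; move: ul; rewrite -cvg_shiftS.
exact: cvg_unique h2 h1.
Qed.

Lemma cut_value_is_cvg M : (forall n, cut_value x n <= M) -> cvgn (cut_value x).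
Proof.
move=> hM; apply: nondecreasing_is_cvgn; first exact: cut_value_nondec.
by exists M => _ [n _ <-].
Qed.

Lemma limit_le M l : cut_value x n @[n --> \oo] --> l ->
  (forall n, cut_value x n <= M) -> l <= M.
Proof.
by move=> ul hM; apply: (cvgr_to_le ul); apply: nearW.
Qed.

Lemma limit_ge l n : cut_value x n @[n --> \oo] --> l -> cut_value x n <= l.
Proof.
move=> ul; rewrite -(cvg_lim _ ul) //; apply: nondecreasing_cvgn_le.
  exact: cut_value_nondec.
by apply/cvg_ex; exists l.
Qed.

End Monotone.

End Orbits.

(** * The cut bounds as coefficient sums *)
Section HilbertSeries.
Variables (R : realType) (K : fieldType) (k : nat).
Hypothesis k_gt0 : (0 < k)%N.

Lemma Htilde_coef n (F : graded_free_resolution (@cut_ideal K k n.+1)) (t : R) i :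
  Htilde F t i.+1 = (cut_poly k t n.+1)`_i.
Proof.
have [r [d [d_gt0 hb <-]]] := cut_ideal_betti t F i k_gt0.
rewrite /Htilde (fsbigE (undup (codom d))); first last.
- move=> j _; rewrite mem_undup => jd; rewrite hb.
  have -> : [set a | d a == j]%SET = finset.set0.
    apply/setP => a; rewrite !inE; apply: contraNF jd => /eqP <-.
    exact: codom_f.
  by rewrite cards0 mulr0 mul0r.
- by move=> j /=; rewrite mem_undup => /codomP[a ->]; apply: d_gt0.
- exact: undup_uniq.
have pos j : j \in undup (codom d) -> j \in [set j | (0 < j)%N].
  by rewrite mem_undup => /codomP[a ->]; apply/mem_set/d_gt0.
rewrite big_mkcond (eq_big_seq _ (fun j jr => ifT _ _ (pos j jr))) -sumrN.
under eq_bigr do rewrite exprS mulN1r !mulNr opprK -mulrA.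
rewrite -mulr_sumr; congr (_ * _).
under eq_bigr => j _ do rewrite hb -sum1_card natr_sum mulr_suml big_mkcond.
rewrite exchange_big /=; apply: eq_bigr => a _.
rewrite (bigD1_seq (d a)) ?undup_uniq ?mem_undup ?codom_f //=.
rewrite inE eqxx mul1r big1 ?addr0 // => j; rewrite inE eq_sym.
by move=> /negPf ->.
Qed.

Lemma cut_boundE n (F : graded_free_resolution (@cut_ideal K k n.+1)) m (q : R) :
  cut_bound F m q = \sum_(i < m) (cut_poly k q n.+1)`_i.
Proof.
rewrite /cut_bound /trunc_series big_ord_recl /= mul0r add0r.
by apply: eq_bigr => i _; rewrite expr1n mulr1; apply: Htilde_coef.
Qed.

End HilbertSeries.

(** * Uniqueness of one-sided Taylor coefficients *)
Section TaylorUniqueness.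
Variable R : realType.
Implicit Types (u : R -> R) (c : nat -> R).

Let right0_gt0 : \forall x \near (0:R)^'+, 0 < x.
Proof. exact: nbhs_right_gt. Qed.

Let cvg_id0 : x @[x --> (0:R)^'+] --> (0 : R).
Proof. by apply: cvg_at_right_filter; apply: cvg_id. Qed.

Lemma taylor_lower m u c : taylor_expansion m.+1 u c -> taylor_expansion m u c.
Proof.
rewrite /taylor_expansion => h.
have h1 : ((u x - trunc_series m.+1 c x) / x ^+ m.+1 * x + c m.+1 * x)
    @[x --> 0^'+] --> 0.
  rewrite -[X in _ --> X](_ : 0 * 0 + c m.+1 * 0 = 0); last by rewrite !mulr0 addr0.
  by apply: cvgD; [apply: cvgM|apply: cvgMr].
apply: cvg_trans h1; apply: near_eq_cvg; near=> x.
have x0 : 0 < x by near: x.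
rewrite /trunc_series big_ord_recr /= exprS.
have xn : x ^+ m != 0 by rewrite expf_neq0 ?gt_eqF.
by field; rewrite xn gt_eqF.
Unshelve. all: by end_near.
Qed.

Lemma poly_small m c :
  (trunc_series m c x / x ^+ m) @[x --> 0^'+] --> (0 : R) ->
  forall i, (i <= m)%N -> c i = 0.
Proof.
elim: m c => [|m IH] c h.
  have h' : (fun _ : R => c 0%N) x @[x --> 0^'+] --> (0 : R).
    apply: cvg_trans h; apply: near_eq_cvg; near=> x.
    by rewrite /trunc_series big_ord1 expr0 mulr1 divr1.
  have e : c 0%N = 0 by apply: (cvg_unique (@norm_hausdorff _ _) (cvg_cst _) h').
  by case.
have h0 : trunc_series m.+1 c x @[x --> 0^'+] --> (0 : R).
  have h1 : (trunc_series m.+1 c x / x ^+ m.+1 * x ^+ m.+1) @[x --> 0^'+] --> (0 : R).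
    rewrite -[X in _ --> X](_ : 0 * 0 ^+ m.+1 = 0); last by rewrite mul0r.
    by apply: cvgM => //; apply: cvg_expn.
  apply: cvg_trans h1; apply: near_eq_cvg; near=> x.
  have x0 : 0 < x by near: x.
  by rewrite divfK // expf_neq0 // gt_eqF.
have c0 : c 0%N = 0.
  suff h1 : trunc_series m.+1 c x @[x --> 0^'+] --> c 0%N.
    exact: (cvg_unique (@norm_hausdorff _ _) h1 h0).
  rewrite -[X in _ --> X](_ : trunc_series m.+1 c 0 = c 0%N); last first.
    rewrite /trunc_series big_ord_recl expr0 mulr1 big1 ?addr0 // => i _.
    by rewrite expr0n mulr0.
  apply: (cvg_ord_sum (N := m.+2) (f := fun i x => c i * x ^+ i)
    (a := fun i => c i * 0 ^+ i)) => i _.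
  by apply: cvgMr; apply: cvg_expn.
have hs : forall i, (i <= m)%N -> c i.+1 = 0.
  apply: (IH (fun i => c i.+1)); apply: cvg_trans h; apply: near_eq_cvg; near=> x.
  have x0 : 0 < x by near: x.
  rewrite [trunc_series m.+1 _ _]/trunc_series big_ord_recl c0 mul0r add0r.
  have -> : \sum_(i < m.+1) c (lift ord0 i) * x ^+ lift ord0 i =
      x * trunc_series m (fun i => c i.+1) x.
    by rewrite mulr_sumr; apply: eq_bigr => i _; rewrite exprS mulrCA.
  by rewrite exprS -mulf_div mulfV ?mul1r // gt_eqF.
by case=> [|i] im //; apply: hs.
Unshelve. all: by end_near.
Qed.

Lemma taylor_unique m u c c' :
  taylor_expansion m u c -> taylor_expansion m u c' ->
  forall i, (i <= m)%N -> c i = c' i.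
Proof.
move=> h h' i im; apply/eqP; rewrite -subr_eq0; apply/eqP.
apply: (@poly_small m (fun i => c i - c' i) _ i im) => {i im}.
have hh : ((u x - trunc_series m c' x) / x ^+ m
    - (u x - trunc_series m c x) / x ^+ m) @[x --> 0^'+] --> (0 : R).
  by rewrite -[X in _ --> X](subr0 0); apply: cvgB.
apply: cvg_trans hh; apply: near_eq_cvg; near=> x.
rewrite -mulrBl; congr (_ / _).
transitivity (trunc_series m c x - trunc_series m c' x); first by ring.
by rewrite /trunc_series -sumrB; apply: eq_bigr => i _; rewrite mulrBl.
Unshelve. all: by end_near.
Qed.

End TaylorUniqueness.

(** * The smallest solution for small failure probability *)
Section Solution.
Variables (R : realType) (k : nat) (q : R).
Hypothesis k_gt1 : (1 < k)%N.
Hypothesis q_ge0 : 0 <= q.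
Hypothesis q_le1 : q <= 1.

Local Notation cut_value := (@cut_value R k q).
Local Notation cut_step := (@cut_step R k q).

Definition limit_value x : R := limn (cut_value x).

Definition solution x : R := x * limit_value x.

(** Factoring out -x, the sign and the power of x cancel against those of g up
    to one factor x. *)
Lemma cut_gE x s : x != 0 -> cut_g x q k (x * s) = x * cut_step x s.
Proof.
move=> x0; rewrite /cut_g /cut_step.
have -> : (1 - q * x) * (1 - x * s) - 1 = -1 * (x * (q + (1 - q * x) * s)) by ring.
rewrite !exprMn; have := k_gt1; case: k => // k' _ /=.
have xk : x ^+ k' != 0 by rewrite expf_neq0.
rewrite [x ^+ k'.+1]exprS; set y := (q + _) ^+ _; set e := (-1) ^+ _.
have ee : e * e = 1 by rewrite -exprMn mulrNN mulr1 expr1n.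
by transitivity (e * e * (x * y)); [field|rewrite ee mul1r].
Qed.

Section BelowCritical.
Hypothesis q_sub : q <= qstar R k.

Lemma qstar_le_bstar : qstar R k <= bstar R k.
Proof. by rewrite qstarE // gerBl exprn_ge0 // ltW ?bstar_gt0. Qed.

Lemma trap_ge0 : 0 <= bstar R k - q.
Proof. by rewrite subr_ge0; apply: le_trans qstar_le_bstar. Qed.

(** The endpoint b* - q is sent to b*^k = b* - q*, which is at most b* - q. *)
Lemma trapE : cut_step 0 (bstar R k - q) = bstar R k - qstar R k.
Proof.
by rewrite /cut_step mulr0 subr0 mul1r addrC subrK qstarE // opprB addrC subrK.
Qed.

Lemma cut_step_antitone x s : 0 <= x <= 1 -> 0 <= s -> cut_step x s <= cut_step 0 s.
Proof.
move=> /andP[x0 x1] s0; apply: lerXn2r.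
- by rewrite nnegrE addr_ge0 // mulr_ge0 // slope_ge0.
- by rewrite nnegrE addr_ge0 // mulr_ge0 // mulr0 subr0.
- by rewrite lerD2l ler_wpM2r // lerD2l lerN2 mulr0 mulr_ge0.
Qed.

Lemma cut_value_trapped x n : 0 <= x <= 1 -> cut_value x n <= bstar R k - q.
Proof.
move=> hx; have /andP[_ x1] := hx; apply: cut_value_le => //; first exact: trap_ge0.
apply: le_trans (cut_step_antitone hx trap_ge0) _.
by rewrite trapE lerD2l lerN2.
Qed.

Lemma cut_value_cvg x : 0 <= x <= 1 -> cut_value x n @[n --> \oo] --> limit_value x.
Proof.
move=> hx; have /andP[_ x1] := hx.
apply: (cut_value_is_cvg q_ge0 q_le1 x1 (M := bstar R k - q)) => n.
exact: cut_value_trapped.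
Qed.

Lemma limit_value_fix x : 0 <= x <= 1 -> limit_value x = cut_step x (limit_value x).
Proof. by move=> /cut_value_cvg; apply: cut_value_fixpoint. Qed.

Lemma limit_value_ge0 x : 0 <= x <= 1 -> 0 <= limit_value x.
Proof.
move=> hx; have /andP[_ x1] := hx.
by have := limit_ge q_ge0 q_le1 x1 0 (cut_value_cvg hx); rewrite cut_value0.
Qed.

Lemma limit_value_min x w : 0 <= x <= 1 -> 0 <= w -> cut_step x w <= w ->
  limit_value x <= w.
Proof.
move=> hx w0 sw; have /andP[_ x1] := hx.
apply: (limit_le (cut_value_cvg hx)) => n; exact: cut_value_le.
Qed.

Lemma solution_smallest :
  \forall x \near (0:R)^'+, smallest_solution k q x (solution x).
Proof.
near=> x.
have x0 : 0 < x by near: x; apply: nbhs_right_gt.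
have x1 : x <= 1 by near: x; apply: nbhs_right_le; exact: ltr01.
have hx : 0 <= x <= 1 by rewrite ltW.
have xn0 : x != 0 by rewrite gt_eqF.
split.
- by rewrite mulr_ge0 ?limit_value_ge0 // ltW.
- by rewrite /solution cut_gE // -limit_value_fix // subrr.
- move=> w w0; have -> : w = x * (w / x) by rewrite mulrC divfK.
  rewrite cut_gE // -mulrBr => /eqP; rewrite mulf_eq0 (negPf xn0) /= subr_eq0.
  move=> /eqP e; rewrite ler_pM2l //; apply: limit_value_min => //.
    by rewrite divr_ge0 // ltW.
  by rewrite -e.
Unshelve. all: by end_near.
Qed.

Lemma limit_value_le0 x : 0 <= x <= 1 -> limit_value x <= limit_value 0.
Proof.
move=> hx; have h0 : 0 <= (0 : R) <= 1 by rewrite lexx ler01.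
apply: limit_value_min => //; first exact: limit_value_ge0.
rewrite [leRHS]limit_value_fix //; apply: cut_step_antitone => //.
exact: limit_value_ge0.
Qed.

(** Continuity at 0: the limit at x is at most the limit at 0 since the step
    decreases with x, and it is at least each of the continuous functions a_n. *)
Lemma limit_value_right : limit_value x @[x --> 0^'+] --> limit_value 0.
Proof.
have h0 : 0 <= (0 : R) <= 1 by rewrite lexx ler01.
apply/cvgrPdist_le => eps eps0.
have [n hn] : exists n, limit_value 0 - eps < cut_value 0 n.
  have lt_eps : limit_value 0 - eps < limit_value 0 by rewrite ltrBlDr ltrDl.
  have [n _ hn] := cvgr_gt _ (cut_value_cvg h0) _ lt_eps.
  by exists n; apply: (hn n) => /=.
have cn : cut_value x n @[x --> 0^'+] --> cut_value 0 n.
  by apply: cvg_at_right_filter; apply: continuous_horner.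
near=> x.
have x0 : 0 < x by near: x; apply: nbhs_right_gt.
have x1 : x <= 1 by near: x; apply: nbhs_right_le; exact: ltr01.
have hx : 0 <= x <= 1 by rewrite ltW.
have h1 : limit_value 0 - eps < cut_value x n by near: x; apply: cvgr_gt cn _ hn.
have h2 := limit_ge q_ge0 q_le1 x1 n (cut_value_cvg hx).
have h3 := limit_value_le0 hx.
rewrite ger0_norm ?subr_ge0 //; lra.
Unshelve. all: by end_near.
Qed.

Definition linear_coef (i : nat) : R := if i == 1%N then limit_value 0 else 0.

Lemma solution_taylor1 : taylor_expansion 1 solution linear_coef.
Proof.
rewrite /taylor_expansion.
have h : (limit_value x - limit_value 0) @[x --> 0^'+] --> (0 : R).
  rewrite -[X in _ --> X](subrr (limit_value 0)); apply: cvgB; last exact: cvg_cst.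
  exact: limit_value_right.
apply: cvg_trans h; apply: near_eq_cvg; near=> x.
have x0 : 0 < x by near: x; apply: nbhs_right_gt.
rewrite /trunc_series 2!big_ord_recr big_ord0 /= /linear_coef /= /solution.
by field; rewrite gt_eqF.
Unshelve. all: by end_near.
Qed.

End BelowCritical.

Section StrictlyBelow.
Hypothesis q_lt : q < qstar R k.

(** For q < q* the trapped endpoint is mapped strictly inside at x = 0, so it is
    still mapped inside at some negative x = -y. *)
Lemma abs_poly_bounded : exists2 y : R, 0 < y <= 1 &
  exists2 M, 0 <= M & forall n, (abs_poly k q n).[y] <= M.
Proof.
pose M := bstar R k - q; have M0 : 0 <= M by apply: trap_ge0; apply: ltW.
pose P := (q%:P + (1 + q *: 'X) * M%:P) ^+ k.
have PE y : P.[y] = cut_step (- y) M by rewrite /P !hornerE /cut_step mulrN opprK.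
have P0 : P.[0] < M by rewrite PE oppr0 trapE ltrD2l ltrN2.
have cP : P.[y] @[y --> 0^'+] --> P.[0].
  by apply: cvg_at_right_filter; apply: continuous_horner.
have /filter_ex[y [y0 y1 hy]] : \forall y \near (0:R)^'+, [/\ 0 < y, y <= 1 & P.[y] < M].
  near=> y; split; near: y.
  - exact: nbhs_right_gt.
  - by apply: nbhs_right_le; exact: ltr01.
  - exact: cvgr_lt cP _ P0.
exists y; first by rewrite y0.
exists M => // n; rewrite -[y]opprK -cut_poly_horner; apply: cut_value_le => //.
  by apply: le_trans (ler01); rewrite oppr_le0 ltW.
by rewrite -PE ltW.
Unshelve. all: by end_near.
Qed.

(** Beyond degree N each term at x is at most (x/y)^N times the term at y. *)
Lemma horner_tail (p : {poly R}) x y N : pos_poly p -> 0 <= x <= y -> 0 < y ->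
  `|p.[- x] - \sum_(i < N) ((-1) ^+ i * p`_i) * x ^+ i| <= (x / y) ^+ N * p.[y].
Proof.
move=> hp /andP[x0 xy] y0.
have sz : (size p <= N + size p)%N by rewrite leq_addl.
rewrite !(horner_coef_wide _ sz) !big_split_ord /= mulrDr.
have -> : \sum_(i < N) p`_i * (- x) ^+ i =
    \sum_(i < N) ((-1) ^+ i * p`_i) * x ^+ i.
  by apply: eq_bigr => i _; rewrite -[- x]mulN1r exprMn mulrCA mulrA.
rewrite addrC addrK; apply: le_trans (ler_norm_sum _ _ _) _.
rewrite -[leLHS]add0r lerD //.
  by rewrite mulr_ge0 ?exprn_ge0 ?divr_ge0 // ?(ltW y0) // sumr_ge0 // => i _;
    rewrite mulr_ge0 ?exprn_ge0 // ltW.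
rewrite mulr_sumr; apply: ler_sum => i _.
rewrite normrM normrX normrN (ger0_norm (hp _)) (ger0_norm x0) mulrCA.
rewrite ler_wpM2l // !exprD mulrA expr_div_n divfK ?expf_neq0 ?gt_eqF //.
by rewrite ler_wpM2l ?exprn_ge0 // lerXn2r // nnegrE // ltW.
Qed.

Definition abs_coef i : R := limn (fun n => (abs_poly k q n)`_i).

Definition series_coef i : R :=
  if i is i'.+1 then (-1) ^+ i' * abs_coef i' else 0.

Lemma abs_coef_cvg i : (abs_poly k q n)`_i @[n --> \oo] --> abs_coef i.
Proof.
have [y /andP[y0 y1] [M M0 hM]] := abs_poly_bounded.
apply: nondecreasing_is_cvgn; first exact: abs_coef_nondec.
exists (M / y ^+ i) => _ [n _ <-]; rewrite ler_pdivlMr ?exprn_gt0 //.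
apply: le_trans (hM n).
have sz : (size (abs_poly k q n) <= i.+1 + size (abs_poly k q n))%N by rewrite leq_addl.
have li : (i < i.+1 + size (abs_poly k q n))%N by rewrite addSn ltnS leq_addr.
rewrite (horner_coef_wide _ sz) (bigD1 (Ordinal li)) //= lerDl sumr_ge0 // => j _.
by rewrite mulr_ge0 ?abs_poly_ge0 ?exprn_ge0 // ltW.
Qed.

Lemma cut_coef_cvg i : (cut_poly k q n)`_i @[n --> \oo] --> series_coef i.+1.
Proof.
under eq_fun do rewrite cut_poly_coef.
by apply: cvgMr; apply: abs_coef_cvg.
Qed.

(** The tail estimate is uniform in n and so passes to the limit.  The factor
    (x/y)^N gives convergence of the series as N grows, and the Taylor estimate
    of order N as x tends to 0. *)
Lemma solution_approx : exists2 y : R, 0 < y <= 1 & exists M, forall x N,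
  0 <= x <= y -> `|solution x - trunc_series N series_coef x| <= x * ((x / y) ^+ N * M).
Proof.
have [y /andP[y0 y1] [M M0 hM]] := abs_poly_bounded.
exists y; first by rewrite y0.
exists M => x N /andP[x0 xy].
have hx : 0 <= x <= 1 by rewrite x0 (le_trans xy).
have -> : trunc_series N series_coef x =
    x * \sum_(i < N) series_coef i.+1 * x ^+ i.
  rewrite /trunc_series big_ord_recl /= mul0r add0r mulr_sumr.
  by apply: eq_bigr => i _; rewrite /= exprS mulrCA.
rewrite /solution -mulrBr normrM (ger0_norm x0) ler_wpM2l //.
have h1 : (cut_value x n - \sum_(i < N) (cut_poly k q n)`_i * x ^+ i) @[n --> \oo]
    --> limit_value x - \sum_(i < N) series_coef i.+1 * x ^+ i.
  apply: cvgB; first exact: cut_value_cvg (ltW q_lt) _ hx.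
  apply: (cvg_ord_sum (f := fun i n => (cut_poly k q n)`_i * x ^+ i)
     (a := fun i => series_coef i.+1 * x ^+ i)) => i _.
  by apply: cvgMl; apply: cut_coef_cvg.
have h2 : `|cut_value x n - \sum_(i < N) (cut_poly k q n)`_i * x ^+ i| @[n --> \oo]
    --> `|limit_value x - \sum_(i < N) series_coef i.+1 * x ^+ i|.
  exact: cvg_norm h1.
apply: (cvgr_to_le h2); apply: nearW => n.
apply: le_trans (_ : (x / y) ^+ N * (abs_poly k q n).[y] <= _); last first.
  by rewrite ler_wpM2l // exprn_ge0 // divr_ge0 // ltW.
rewrite /cut_value cut_poly_horner.
under eq_bigr do rewrite cut_poly_coef.
by apply: horner_tail => //; [apply: abs_poly_ge0|rewrite x0].
Qed.

Lemma solution_power_series : power_series_expansion solution series_coef.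
Proof.
have [y /andP[y0 y1] [M hM]] := solution_approx.
rewrite /power_series_expansion; near=> x.
have x0 : 0 < x by near: x; apply: nbhs_right_gt.
have xy : x < y by near: x; apply: nbhs_right_lt.
have h : (x * ((x / y) ^+ N * M)) @[N --> \oo] --> (0 : R).
  rewrite -[X in _ --> X](_ : x * (0 * M) = 0); last by rewrite mul0r mulr0.
  apply: cvgMr; apply: cvgMl; apply: cvg_expr.
  by rewrite ger0_norm ?divr_ge0 ?ltW // ltr_pdivrMr // mul1r.
apply/cvgrPdist_le => eps eps0; near=> N.
apply: le_trans (hM x N _) _; first by rewrite !ltW.
near: N; apply: cvgr_le h _ eps0.
Unshelve. all: by end_near.
Qed.

Lemma solution_taylor m : taylor_expansion m solution series_coef.
Proof.
have [y /andP[y0 y1] [M hM]] := solution_approx.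
rewrite /taylor_expansion.
have h : (x * (M / y ^+ m)) @[x --> (0:R)^'+] --> (0 : R).
  rewrite -[X in _ --> X](mul0r (M / y ^+ m)); apply: cvgMl.
  by apply: cvg_at_right_filter; apply: cvg_id.
apply/cvgrPdist_le => eps eps0; near=> x.
have x0 : 0 < x by near: x; apply: nbhs_right_gt.
have xy : x < y by near: x; apply: nbhs_right_lt.
rewrite sub0r normrN normrM normfV normrX (ger0_norm (ltW x0)).
rewrite ler_pdivrMr ?exprn_gt0 //.
apply: le_trans (hM x m _) _; first by rewrite !ltW.
have -> : x * ((x / y) ^+ m * M) = x * (M / y ^+ m) * x ^+ m.
  by rewrite expr_div_n; ring.
rewrite ler_wpM2r ?exprn_ge0 ?(ltW x0) //.
near: x; apply: cvgr_le h _ eps0.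
Unshelve. all: by end_near.
Qed.

End StrictlyBelow.

End Solution.

(** * The critical case *)
Section AtCritical.
Variables (R : realType) (k : nat) (q : R).
Hypothesis k_gt1 : (1 < k)%N.
Hypothesis q_ge0 : 0 <= q.
Hypothesis q_le1 : q <= 1.
Hypothesis q_crit : q = qstar R k.

Let q_sub : q <= qstar R k.
Proof. by rewrite q_crit. Qed.

Local Notation l := (limit_value k q).
Local Notation b := (bstar R k).

Lemma critical_limit : q + l 0 = b.
Proof.
have h0 : 0 <= (0 : R) <= 1 by rewrite lexx ler01.
have l0 := limit_value_ge0 k_gt1 q_ge0 q_le1 q_sub h0.
have := limit_value_fix k_gt1 q_ge0 q_le1 q_sub h0.
rewrite /cut_step mulr0 subr0 mul1r => e.
apply: gap_eq_qstar => //; first exact: addr_ge0.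
by rewrite -e addrK.
Qed.

(** Suppose (l x - l 0) / x tends to c_2, and let y x = q + (1 - q x) (l x).
    Factoring y^k - b^k at b = b* gives l x - l 0 = (y x - b) S x, S x tending to
    k b^(k-1) = 1.  Divided by x this reads
    c_2 = (c_2 - q l 0) * 1 in the limit, against q > 0 and l 0 > 0. *)
Lemma critical_not_taylor2 c : ~ taylor_expansion 2 (solution k q) c.
Proof.
have k_gt0 := ltnW k_gt1; move=> h2; have h1 := taylor_lower h2.
have c01 := taylor_unique h1 (solution_taylor1 k_gt1 q_ge0 q_le1 q_sub).
have c0 : c 0%N = 0 by rewrite c01.
have c1 : c 1%N = l 0 by rewrite c01.
have b0 := bstar_gt0 R k_gt1.
pose delta x := (l x - l 0) / x.
pose y x := q + (1 - q * x) * l x.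
pose S x := \sum_(i < k) y x ^+ (k.-1 - i) * b ^+ i.
have hx : \forall x \near (0:R)^'+, 0 <= x <= 1.
  near=> x; rewrite ltW /=; last by near: x; apply: nbhs_right_gt.
  by near: x; apply: nbhs_right_le; exact: ltr01.
have hid : x @[x --> (0:R)^'+] --> (0 : R).
  by apply: cvg_at_right_filter; apply: cvg_id.
have hl := limit_value_right k_gt1 q_ge0 q_le1 q_sub.
have hdelta : delta x @[x --> 0^'+] --> c 2%N.
  have h : ((solution k q x - trunc_series 2 c x) / x ^+ 2 + c 2%N)
      @[x --> 0^'+] --> c 2%N.
    rewrite -[X in _ --> X]add0r; apply: cvgD => //; exact: cvg_cst.
  apply: cvg_trans h; apply: near_eq_cvg; near=> x.
  have x0 : 0 < x by near: x; apply: nbhs_right_gt.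
  rewrite /delta /solution /trunc_series 3!big_ord_recr big_ord0 /= c0 c1.
  by field; rewrite gt_eqF.
have hy : y x @[x --> 0^'+] --> b.
  rewrite -critical_limit -[X in _ --> q + X]mul1r.
  apply: cvgD; first exact: cvg_cst.
  apply: cvgM => //.
  rewrite -[X in _ --> X](_ : 1 - q * 0 = 1); last by rewrite mulr0 subr0.
  by apply: cvgB; [apply: cvg_cst|apply: cvgMr].
have hS : S x @[x --> 0^'+] --> (1 : R).
  rewrite -[X in _ --> X](bstar_expn R k_gt1).
  have -> : k%:R * b ^+ k.-1 = \sum_(i < k) b ^+ (k.-1 - i) * b ^+ i.
    transitivity (\sum_(i < k) b ^+ k.-1).
      by rewrite sumr_const card_ord mulr_natl.
    apply: eq_bigr => i _.
    have ik : (i <= k.-1)%N by rewrite -ltnS prednK.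
    by rewrite -exprD subnK.
  apply: (cvg_ord_sum (f := fun i x => y x ^+ (k.-1 - i) * b ^+ i)
     (a := fun i => b ^+ (k.-1 - i) * b ^+ i)) => i _.
  by apply: cvgMl; apply: cvg_expn.
have hE : \forall x \near (0:R)^'+, (delta x - q * l x) * S x = delta x.
  near=> x.
  have x0 : 0 < x by near: x; apply: nbhs_right_gt.
  have hx1 : 0 <= x <= 1 by near: x.
  have h0 : 0 <= (0 : R) <= 1 by rewrite lexx ler01.
  have e1 := limit_value_fix k_gt1 q_ge0 q_le1 q_sub hx1.
  have e0 := limit_value_fix k_gt1 q_ge0 q_le1 q_sub h0.
  have e2 : l x - l 0 = (y x - b) * S x.
    rewrite {1}e1 {1}e0 /cut_step mulr0 subr0 mul1r critical_limit -/(y x).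
    exact: subrXX.
  have e3 : y x - b = x * (delta x - q * l x).
    rewrite /y /delta -critical_limit; field; by rewrite gt_eqF.
  by apply: (mulfI (lt0r_neq0 x0)); rewrite mulrA -e3 -e2 [RHS]mulrC divfK // gt_eqF.
have hlim : delta x @[x --> 0^'+] --> (c 2%N - q * l 0) * 1.
  have h : ((delta x - q * l x) * S x) @[x --> 0^'+] --> (c 2%N - q * l 0) * 1.
    apply: cvgM => //; apply: cvgB => //; exact: cvgMr.
  by apply: cvg_trans h; apply: near_eq_cvg.
have e : c 2%N = (c 2%N - q * l 0) * 1.
  exact: (cvg_unique (@norm_hausdorff _ _) hdelta hlim).
have q0 : 0 < q by rewrite q_crit qstar_gt0.
have l0 : 0 < l 0.
  have h0 : 0 <= (0 : R) <= 1 by rewrite lexx ler01.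
  rewrite (limit_value_fix k_gt1 q_ge0 q_le1 q_sub h0) /cut_step mulr0 subr0 mul1r.
  by rewrite critical_limit exprn_gt0.
by have := mulr_gt0 q0 l0; rewrite mulr1 in e; lra.
Unshelve. all: by end_near.
Qed.

End AtCritical.

(** * Divergence above the critical parameter *)
Section AboveCritical.
Variables (R : realType) (k : nat) (q : R).
Hypothesis k_gt1 : (1 < k)%N.
Hypothesis q_le1 : q <= 1.
Hypothesis q_sup : qstar R k < q.

Let q_gt0 : 0 < q.
Proof. exact: lt_trans (qstar_gt0 R k_gt1) q_sup. Qed.

Let q_ge0 : 0 <= q. Proof. exact: ltW. Qed.

Local Notation D n := (abs_poly k q n).

Lemma abs_poly0 n : (D n)`_0 = cut_value k q 0 n.
Proof. by rewrite /cut_value cut_poly_horner oppr0 horner_coef0. Qed.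

Lemma abs_poly_unbounded A : exists n0, forall n, (n0 <= n)%N -> A <= (D n)`_0.
Proof.
have [[n0 h]|hn] := pselect (exists n, A <= (D n)`_0).
  exists n0 => n nn; apply: le_trans h _; exact: abs_coef_nondec.
have bd n : cut_value k q 0 n <= A.
  rewrite -abs_poly0 leNgt; apply/negP => h; apply: hn; exists n; exact: ltW.
have cv := cut_value_is_cvg q_ge0 q_le1 ler01 bd.
have := cut_value_fixpoint cv; set l := lim _ => e.
have l0 : 0 <= l by have := limit_ge q_ge0 q_le1 ler01 0 cv; rewrite cut_value0.
have := gap_le_qstar k_gt1 (addr_ge0 q_ge0 l0).
move: e; rewrite /cut_step mulr0 subr0 mul1r => <-.
by rewrite addrK leNgt q_sup.
Qed.

Lemma abs_poly_coef_gt0 n i : (i < n)%N -> 0 < (D n)`_i.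
Proof.
elim: n i => // n IH i; rewrite ltnS => le_in /=.
set B := _ + _; have cE j : B`_j.+1 = (D n)`_j.+1 + q * (D n)`_j.
  by rewrite coefD coefC add0r mulrDl mul1r -scalerAl coefD coefZ coefXM.
have c0 : B`_0 = q + (D n)`_0.
  by rewrite coefD coefC mulrDl mul1r -scalerAl coefD coefZ coefXM mulr0 addr0.
have B0 : 0 < B`_0 by rewrite c0 ltr_pwDl // abs_poly_ge0.
have Bpos : pos_poly B.
  case=> [|j]; first exact: ltW.
  by rewrite cE addr_ge0 ?mulr_ge0 ?abs_poly_ge0.
case: k k_gt1 => // k' _; apply: coefXn_gt0 => //.
case: i le_in => [//|i] lin; rewrite cE ltr_wpDl ?abs_poly_ge0 //.
by rewrite mulr_gt0 // IH.
Qed.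

(** Finitely many positive ratios have a positive lower bound. *)
Lemma grows_init N (p : {poly R}) : (forall i, (i <= N)%N -> 0 < p`_i) ->
  exists2 rho, 0 < rho & grows rho N p.
Proof.
elim: N => [|N IH] hp; first by exists 1; rewrite ?ltr01.
have [|rho rho0 hr] := IH; first by move=> i iN; apply: hp; apply: leqW.
have p1 : 0 < p^`()`_N by rewrite coef_deriv pmulrn_lgt0 // hp.
have p0 : 0 < p`_N by rewrite hp // leqnSn.
exists (Num.min rho (p^`()`_N / p`_N)); first by rewrite lt_min rho0 divr_gt0.
move=> i; rewrite ltnS leq_eqVlt => /predU1P[->|iN].
  by rewrite -ler_pdivlMr // ge_min lexx orbT.
apply: le_trans (hr i iN); rewrite ler_wpM2r ?ge_min ?lexx //.
by rewrite ltW // hp // ltnW // ltnW.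
Qed.

(** Once f_0 >= 3 q the affine part costs at most a factor 3/4, and the power
    gains a factor k >= 2. *)
Lemma grows_step rho N n : 0 <= rho -> 3 * q <= (D n)`_0 ->
  grows rho N (D n) -> grows (3 / 2 * rho) N (D n.+1).
Proof.
move=> rho0 big g.
have g' : grows (3 / 4 * rho) N (q%:P + (1 + q *: 'X) * D n).
  apply: (grows_affine _ _ _ _ _ g) => //; [exact: abs_poly_ge0|lra|lra|].
  rewrite mulrDl; have := mulr_ge0 q_ge0 (abs_poly_ge0 k q_ge0 n 0%N).
  have h : 3 / 4 * (q + (D n)`_0) <= (D n)`_0 by lra.
  by have := ler_wpM2l rho0 h; rewrite mulrCA mulrA; lra.
have Bpos : pos_poly (q%:P + (1 + q *: 'X) * D n).
  apply: pos_polyD; first exact: pos_polyC.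
  apply: pos_polyM; last exact: abs_poly_ge0.
  apply: pos_polyD; first by rewrite -polyC1; apply: pos_polyC.
  by rewrite -mul_polyC; apply: pos_polyM (pos_polyX _); apply: pos_polyC.
have := growsXn k Bpos g'; apply: grows_le; first exact: pos_polyXn.
have k2 : 2 <= (k%:R : R) by rewrite (ler_nat R 2).
by have := ler_wpM2r (_ : 0 <= 3 / 4 * rho) k2; lra.
Qed.

Lemma grows_unbounded N C : exists n0, forall n, (n0 <= n)%N -> grows C N (D n).
Proof.
have [n1 h1] := abs_poly_unbounded (3 * q).
pose n2 := maxn n1 N.+1.
have [|rho rho0 g0] := @grows_init N (D n2).
  by move=> i iN; apply: abs_poly_coef_gt0; rewrite leq_max ltnS iN orbT.
have gj j : grows ((3 / 2) ^+ j * rho) N (D (n2 + j)).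
  elim: j => [|j IH]; first by rewrite expr0 mul1r addn0.
  rewrite addnS exprS -mulrA; apply: grows_step => //.
    by rewrite mulr_ge0 ?exprn_ge0 ?ltW //; lra.
  by apply: h1; apply: leq_trans (leq_addr _ _); rewrite leq_maxl.
have [j0 hj0] : exists j0, forall j, (j0 <= j)%N -> C <= (3 / 2) ^+ j * rho.
  have bern j : 1 + j%:R / 2 <= (3 / 2 : R) ^+ j.
    elim: j => [|j IH]; first by rewrite mul0r addr0 expr0.
    by rewrite exprS -natr1; have := ler0n R j; lra.
  pose j0 := Num.bound `|2 * (C / rho)|.
  have hj : 2 * (C / rho) <= j0%:R.
    by apply: le_trans (ler_norm _) _; apply/ltW/archi_boundP/normr_ge0.
  exists j0 => j jj; rewrite -ler_pdivrMr //; apply: le_trans (bern j).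
  have : j0%:R <= j%:R :> R by rewrite ler_nat.
  lra.
exists (n2 + j0)%N => n nn.
have -> : n = (n2 + (n - n2))%N.
  by rewrite subnKC // (leq_trans _ nn) // leq_addr.
apply: grows_le (gj _); first exact: abs_poly_ge0.
by apply: hj0; rewrite leq_subRL // (leq_trans _ nn) // leq_addr.
Qed.

(** The growth rate 2 m makes each of the first m + 1 coefficients at least twice
    the previous one. *)
Lemma alternating_unbounded m A : exists n0, forall n, (n0 <= n)%N ->
  A <= (-1) ^+ m * \sum_(i < m.+1) (cut_poly k q n)`_i.
Proof.
have [n1 h1] := grows_unbounded m (2 * m%:R).
have [n2 h2] := abs_poly_unbounded (2 * `|A|).
exists (maxn n1 n2) => n; rewrite geq_max => /andP[/h1 g /h2 big].
have ratio i : (i < m)%N -> 2 * (D n)`_i <= (D n)`_i.+1.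
  move=> im; have := g i im; rewrite coef_deriv -[leRHS]mulr_natl.
  have m0 : 0 < (m%:R : R) by rewrite ltr0n (leq_ltn_trans _ im).
  rewrite mulrAC -ler_pdivlMr // => h; apply: le_trans h _.
  rewrite ler_pdivrMr // mulrC ler_wpM2l ?abs_poly_ge0 // ler_nat.
  exact: im.
under eq_bigr do rewrite cut_poly_coef.
have /andP[h _] := alternating_sum_bounds (abs_poly_ge0 k q_ge0 n 0%N) ratio.
apply: le_trans h; rewrite ler_pdivlMr //.
have mono : forall j, (j <= m)%N -> (D n)`_0 <= (D n)`_j.
  elim=> [//|j IH] jm; apply: le_trans (IH (ltnW jm)) _.
  by apply: le_trans (ratio j jm); have := abs_poly_ge0 k q_ge0 n j; lra.
have := mono m (leqnn m); have := ler_norm A; lra.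
Qed.

End AboveCritical.

Theorem theorem4p5 (R : realType) (K : fieldType) (k m : nat) (q : R)
  (F : forall n : nat, graded_free_resolution (@cut_ideal K k n))
  (hk : (2 <= k)%N) (hm : (1 <= m)%N) (hq0 : 0 <= q) (hq1 : q <= 1) :
  (q <= qstar R k ->
     exists u : R -> R,
       [/\ \forall x \near 0^'+, smallest_solution k q x (u x),
           q < qstar R k -> exists2 c : nat -> R,
             power_series_expansion u c &
             cut_bound (F n) m q @[n --> \oo] --> trunc_series m c 1,
           m = 1%N -> exists c : nat -> R, taylor_expansion m u c &
           forall c : nat -> R, taylor_expansion m u c ->
             cut_bound (F n) m q @[n --> \oo] --> trunc_series m c 1])
  /\
  (qstar R k < q ->
     (odd m -> cut_bound (F n) m q @[n --> \oo] --> +oo) /\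
     (~~ odd m -> cut_bound (F n) m q @[n --> \oo] --> -oo)).
Proof.
have k_gt0 : (0 < k)%N by apply: ltnW.
split=> [q_sub|q_sup]; last first.
  case: m hm => // m' _.
  have bnd A : \forall n \near \oo, A <= (-1) ^+ m' * cut_bound (F n) m'.+1 q.
    have [n0 h0] := alternating_unbounded hk hq1 q_sup m' A.
    exists n0.+1 => // -[//|n] /=; rewrite ltnS => nn.
    by rewrite cut_boundE //; apply: h0; apply: leqW.
  split=> /= om.
    apply/cvgryPge => A; apply: filterS (bnd A) => n.
    by rewrite -signr_odd (negPf om) expr0 mul1r.
  apply/cvgrNyPle => A; apply: filterS (bnd (- A)) => n.
  by rewrite -signr_odd; move: om; rewrite negbK => ->; rewrite expr1 mulN1r lerN2.
have lim_shift (l : R) :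
    (\sum_(i < m) (cut_poly k q n)`_i) @[n --> \oo] --> l ->
    cut_bound (F n) m q @[n --> \oo] --> l.
  rewrite -cvg_shiftS => h; rewrite -cvg_shiftS; apply: cvg_trans h.
  apply: near_eq_cvg; apply: nearW => n /=.
  by rewrite cut_boundE.
exists (solution k q); split.
- exact: solution_smallest.
- move=> q_lt; exists (series_coef k q); first exact: solution_power_series.
  apply: lim_shift; rewrite /trunc_series big_ord_recl /= mul0r add0r.
  apply: (cvg_ord_sum (f := fun i n => (cut_poly k q n)`_i)
    (a := fun i => series_coef k q i.+1 * 1 ^+ i.+1)) => i _.
  by rewrite expr1n mulr1; apply: cut_coef_cvg.
- by move=> ->; exists (linear_coef k q); apply: solution_taylor1.
- move=> c hc; have [q_lt|q_ge] := ltP q (qstar R k).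
    have cE := taylor_unique hc (solution_taylor hk hq0 hq1 q_lt m).
    apply: lim_shift; rewrite /trunc_series big_ord_recl expr0 mulr1.
    rewrite cE // [series_coef _ _ _]/= add0r.
    apply: (cvg_ord_sum (f := fun i n => (cut_poly k q n)`_i)
      (a := fun i => c i.+1 * 1 ^+ i.+1)) => i im.
    by rewrite expr1n mulr1 cE //; apply: cut_coef_cvg.
  have q_crit : q = qstar R k by apply/eqP; rewrite eq_le q_sub q_ge.
  have [m1|m1] := leqP m 1; last first.
    have t2 : taylor_expansion 2 (solution k q) c.
      move: hc; rewrite -(subnKC m1); elim: (m - 2)%N => [|j IH]; first by rewrite addn0.
      by rewrite addnS => /taylor_lower.
    by case: (critical_not_taylor2 hk hq0 hq1 q_crit t2).
  have {m1} m1 : m = 1%N by apply/eqP; rewrite eqn_leq m1.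
  rewrite m1 in hc lim_shift *.
  have cE := taylor_unique hc (solution_taylor1 hk hq0 hq1 q_sub).
  apply: lim_shift; rewrite /trunc_series 2!big_ord_recr big_ord0 /= !cE //=.
  rewrite /linear_coef /= mul0r !add0r expr1n mulr1.
  under eq_fun do rewrite big_ord1 -horner_coef0.
  by apply: (cut_value_cvg hk hq0 hq1 q_sub); rewrite lexx ler01.
Qed.
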